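(* Let $(N_t)_{t\ge0}$ be a branching process on $\mathbb N_0^*$ whose probability generating functions $(F_{s,t})_{(s,t)\in\Delta}$ form an absolutely continuous reverse evolution family in $\mathbb D$ with associated Herglotz vector field $\Phi(z,t)=q_tz+\sum_{n\in\mathbb N_0\setminus\{1\}}\alpha_t(n)(z-z^n)$, $(q_t,\alpha_t)$ a generating family. The following are equivalent: (1) $\mathbb E^{(s,n)}[N_t]<\infty$ for all $n\in\mathbb N$ and $(s,t)\in\Delta$; (2) $\mathbb E^{(0,1)}[N_t]<\infty$ for all $t\ge0$; (3) $F_{0,t}(1)=1$ and $F'_{0,t}(1)<\infty$ for all $t\ge0$; (4) $F_{s,t}(1)=1$ and $F'_{s,t}(1)<\infty$ for all $(s,t)\in\Delta$; (5) $\Phi(1,t)=0$ for a.e. $t\ge0$ and $t\mapsto\Phi'(1,t)$ is in $L^1_{\rm loc}$; (6) $q_t=0$ for a.e. $t\ge0$ and $t\mapsto\sum_{n\in\mathbb N_0\setminus\{1\}}(n+1)\alpha_t(n)$ is in $L^1_{\rm loc}$. If these hold, then $\mathbb E^{(s,n)}[N_t]=nF'_{s,t}(1)=n\exp\big(-\int_s^t\Phi'(1,r)\,\mathrm dr\big)$ for all $n\in\mathbb N$ and $(s,t)\in\Delta$.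
   Context: $\Delta=\{(s,t):0\le s\le t\}$, $\mathbb D=\{|z|<1\}$, $\mathbb N_0^*=\{0,1,2,\dots\}\cup\{\infty\}$; $L^1_{\rm loc}$: integrable on compact subintervals. A branching process on $\mathbb N_0^*$ is a Markov family $(N_t)$ (probabilities $\mathbb P^{(s,n)}$ with $\mathbb P^{(s,n)}[N_s=n]=1$ and Markov property $\mathbb E^{(s,n)}[f(N_u)|\mathcal F_{[s,t]}]=\int f(y)\ell_{t,u}(N_t,\mathrm dy)$) with transition kernels $(\ell_{s,t})$ on $\mathbb N_0^*$ satisfying $\ell_{s,s}(n,\cdot)=\delta_n$, $\ell_{s,t}\star\ell_{t,u}=\ell_{s,u}$, weak continuity of $(s,t)\mapsto\ell_{s,t}(n,\cdot)$ for $n\in\mathbb N_0$, $\ell_{s,t}(m,\cdot)\ast\ell_{s,t}(n,\cdot)=\ell_{s,t}(m+n,\cdot)$, $\ell_{s,t}(0,\cdot)=\delta_0$, $\ell_{s,t}(\infty,\cdot)=\delta_\infty$. Its probability generating functions: $F_{s,t}(z)=\sum_{n\ge0}\ell_{s,t}(1,\{n\})z^n$. Absolutely continuous reverse evolution family: $F_{s,s}={\rm id}$, $F_{s,u}=F_{s,t}\circ F_{t,u}$, $|F_{s,u}(z)-F_{s,t}(z)|\le\int_t^u f_z$ with $f_z\in L^1_{\rm loc}$; its associated Herglotz vector field $\Phi$ is the a.e.-unique function with $\frac{\mathrm d}{\mathrm ds}F_{s,t}(z)=\Phi(F_{s,t}(z),s)$ a.e. on $[0,t]$, and it has the stated form with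 $q_t\ge0$, $\alpha_t(n)\ge0$, $t\mapsto\alpha_t(n)$ measurable, $t\mapsto q_t$ and $t\mapsto\sum_n\alpha_t(n)$ in $L^1_{\rm loc}$. Notation: $F^{(n)}(1):=\lim_{\mathbb R\ni x\to1^-}F^{(n)}(x)$, $\Phi^{(n)}(1,t):=\lim_{\mathbb R\ni x\to1^-}\Phi^{(n)}(x,t)$ (spatial derivatives). *)

(* Defs.v *)
From HB Require Import structures.
From mathcomp Require Import all_boot all_order all_algebra.
From mathcomp Require Import all_classical all_reals all_analysis.
From mathcomp.real_closed Require Export complex.
Set Implicit Arguments.
Unset Strict Implicit.
Unset Printing Implicit Defensive.
Import Order.TTheory GRing.Theory Num.Theory.
Import numFieldNormedType.Exports.
Local Open Scope classical_set_scope.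
Local Open Scope ring_scope.

(* The state space N_0^* = {0,1,2,...} \cup {oo}: [Some k] is k, [None] is oo. *)
Definition N0s := option nat.

Definition addN0s (m n : N0s) : N0s :=
  match m, n with Some a, Some b => Some (a + b)%N | _, _ => None end.

Definition extN0s {R : realType} (m : N0s) : \bar R :=
  match m with Some k => (k%:R)%:E | None => +oo%E end.

Section Defs.
Variable R : realType.

(* Measures on N_0^* are given by their mass functions mu : N0s -> R.  *)

Definition is_prob (mu : N0s -> R) : Prop :=
  (forall k, 0 <= mu k) /\
  ((mu None)%:E + \sum_(k <oo) (mu (Some k))%:E = 1%:E)%E.

Definition mass_fin (mu : N0s -> R) : R := limn (series (fun k => mu (Some k))).
Definition mass (mu : N0s -> R) : R := mu None + mass_fin mu.

Definition kint (mu : N0s -> R) (f : N0s -> R) : R :=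
  mu None * f None + limn (series (fun k => mu (Some k) * f (Some k))).

(* convolution of measures on N_0^*: image of mu (x) nu under addN0s *)
Definition conv (mu nu : N0s -> R) : N0s -> R := fun k =>
  match k with
  | Some k => \sum_(i < k.+1) mu (Some (i : nat)) * nu (Some (k - i)%N)
  | None => mu None * mass nu + mass_fin mu * nu None
  end.

Definition dirac_N0s (m : N0s) : N0s -> R := fun k => (k == m)%:R.

(* continuous functions on N_0^* (one-point compactification of N_0) *)
Definition cont_N0s (f : N0s -> R) : Prop :=
  (fun k => f (Some k)) @ \oo --> f None.

Definition DeltaSet : set (R * R) := [set st | 0 <= st.1 <= st.2].

(* transition kernels (ell_{s,t})_{(s,t) in Delta}: ell s t m k = ell_{s,t}(m,{k}) *)
Definition branching_kernels (ell : R -> R -> N0s -> N0s -> R) : Prop :=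
  [/\ (forall s t m, 0 <= s <= t -> is_prob (ell s t m)),
      (forall s m, 0 <= s -> ell s s m =1 dirac_N0s m),
      (forall s t u m k, 0 <= s <= t -> t <= u ->
         ((ell s t m None * ell t u None k)%:E
          + \sum_(j <oo) (ell s t m (Some j) * ell t u (Some j) k)%:E
          = (ell s u m k)%:E)%E),
      (forall (n : nat) (f : N0s -> R), cont_N0s f ->
         {within DeltaSet, continuous (fun st => kint (ell st.1 st.2 (Some n)) f)}) &
      (forall s t, 0 <= s <= t ->
         [/\ (forall m n, ell s t (addN0s m n) =1 conv (ell s t m) (ell s t n)),
             ell s t (Some 0%N) =1 dirac_N0s (Some 0%N) &
             ell s t None =1 dirac_N0s None])].

Definition nat_filtration d (Omega : measurableType d) (N : R -> Omega -> N0s)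
  (s t : R) : set (set Omega) :=
  <<s [set A | exists r, r \in `[s, t] /\ exists B : set N0s, A = N r @^-1` B] >>.

Definition branching_process d (Omega : measurableType d)
  (P : R -> N0s -> probability Omega R) (N : R -> Omega -> N0s)
  (ell : R -> R -> N0s -> N0s -> R) : Prop :=
  [/\ branching_kernels ell,
      (forall t k, 0 <= t -> measurable (N t @^-1` [set k])),
      (forall s n, 0 <= s -> P s n (N s @^-1` [set n]) = 1%:E) &
      (* Markov property:
         E^{(s,n)}[f(N_u) | F_[s,t]] = int f(y) ell_{t,u}(N_t, dy) *)
      (forall s t u n (A : set Omega) (f : N0s -> R),
         0 <= s <= t -> t <= u -> (exists M, forall x, `|f x| <= M) ->
         nat_filtration N s t A ->
         (\int[P s n]_(w in A) (f (N u w))%:E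
          = \int[P s n]_(w in A) (kint (ell t u (N t w)) f)%:E)%E)].

Definition expect d (Omega : measurableType d)
  (P : R -> N0s -> probability Omega R) (N : R -> Omega -> N0s)
  (s : R) (n : N0s) (t : R) : \bar R :=
  (\int[P s n]_w extN0s (N t w))%E.

Local Open Scope complex_scope.

Definition cmod (z : R[i]) : R := Num.sqrt (complex.Re z ^+ 2 + complex.Im z ^+ 2).
Definition inD (z : R[i]) : Prop := cmod z < 1.

Definition cseries (a : nat -> R) (w : nat -> R[i]) : R[i] :=
  limn (series (fun n => a n * complex.Re (w n)))
  +i* limn (series (fun n => a n * complex.Im (w n))).

Definition pgf (p : N0s -> R) (z : R[i]) : R[i] :=
  cseries (fun n => p (Some n)) (fun n => z ^+ n).

Definition pgfs (ell : R -> R -> N0s -> N0s -> R) (s t : R) : R[i] -> R[i] :=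
  pgf (ell s t (Some 1%N)).

Definition on_reals (g : R[i] -> R[i]) (x : R) : R := complex.Re (g x%:C).

(* value at 1: g(1) := lim_{x -> 1^-} g(x) (in the extended reals) *)
Definition at1 (g : R -> R) : \bar R := lim ((g x)%:E @[x --> 1^'-]).

Definition L1loc (f : R -> \bar R) : Prop :=
  forall T, 0 <= T -> (@lebesgue_measure R).-integrable `[0, T] f.

Definition abs_cont_rev_evol_family (F : R -> R -> R[i] -> R[i]) : Prop :=
  [/\ (forall s t z, 0 <= s <= t -> inD z -> inD (F s t z)),
      (forall s z, 0 <= s -> inD z -> F s s z = z),
      (forall s t u z, 0 <= s <= t -> t <= u -> inD z ->
         F s u z = F s t (F t u z)) &
      (forall z, inD z -> exists fz : R -> R, L1loc (fun x => (fz x)%:E) /\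
         forall s t u, 0 <= s <= t -> t <= u ->
           ((cmod (F s u z - F s t z))%:E
            <= \int[@lebesgue_measure R]_(x in `[t, u]) (fz x)%:E)%E)].

(* generating family (q_t, alpha_t); alpha t n for n <> 1 (n = 1 ignored) *)
Definition generating_family (q : R -> R) (alpha : R -> nat -> R) : Prop :=
  [/\ (forall t, 0 <= t -> 0 <= q t),
      (forall t n, 0 <= t -> 0 <= alpha t n),
      (forall n, measurable_fun [set t : R | 0 <= t] (fun t => alpha t n)),
      L1loc (fun t => (q t)%:E) &
      L1loc (fun t => (\sum_(n <oo | n != 1%N) (alpha t n)%:E)%E)].

Definition herglotz (q : R -> R) (alpha : R -> nat -> R) (z : R[i]) (t : R) : R[i] :=
  (q t)%:C * z
  + cseries (fun n => if n == 1%N then 0 else alpha t n) (fun n => z - z ^+ n).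

Definition associated_vector_field (F : R -> R -> R[i] -> R[i])
  (Phi : R[i] -> R -> R[i]) : Prop :=
  forall t z, 0 <= t -> inD z ->
    {ae @lebesgue_measure R, forall s, s \in `[0, t] ->
      [/\ derivable (fun r => complex.Re (F r t z)) s 1,
          derivable (fun r => complex.Im (F r t z)) s 1,
          derive1 (fun r => complex.Re (F r t z)) s = complex.Re (Phi (F s t z) s) &
          derive1 (fun r => complex.Im (F r t z)) s = complex.Im (Phi (F s t z) s)]}.

End Defs.

(* Main.v *)
(**
A measure mu on N_0^* with generating function G has the secant slopes
  S_mu(x) = (mu(N_0^* ) - G(x)) / (1 - x)
          = mu(oo) / (1 - x) + sum_k mu(k) (1 + x + ... + x^(k-1)),
which are nondecreasing on [0, 1) and tend to the mean of mu, in [0, +oo], as x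
increases to 1. Regard the rates at time r as the measure nu_r with mass q_r at
oo and alpha_r(k) at k. Then Phi(x, r) / (1 - x) = S_{nu_r}(x) - nu_r(N_0^* ),
so the evolution equation says that r |-> ln (1 - F_{r,t}(x)) has derivative
nu_r(N_0^* ) - S_{nu_r}(F_{r,t}(x)) almost everywhere. This function is
absolutely continuous, because a generating function moves every point of
[0, 1) by at most 1 - p_1, which is controlled by its displacement at the two
points 0 and 1/2. Hence
  int_s^t S_{nu_r}(F_{r,t}(x)) dr
    = ln ((1 - F_{s,t}(x)) / (1 - x)) + int_s^t nu_r(N_0^* ) dr.
The quotient on the right is the secant slope of F_{s,t}. Letting x increase to
1, monotone convergence turns both sides into means: the mean of nu_r is
locally integrable in r if and only if the process has finite means, and then
  int_s^t mean(nu_r) dr = ln (mean of F_{s,t}) + int_s^t nu_r(N_0^* ) dr.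
Finally Phi'(1, r) = nu_r(N_0^* ) - mean(nu_r) wherever nu_r(oo) = 0.
*)
Require Import Defs.
From mathcomp Require Import all_boot all_order all_algebra.
From mathcomp Require Import all_classical all_reals all_analysis.
From mathcomp Require Import measurable_realfun.
From mathcomp Require Import ring lra.
Set Implicit Arguments.
Unset Strict Implicit.
Unset Printing Implicit Defensive.
Import Order.TTheory GRing.Theory Num.Theory.
Import numFieldNormedType.Exports.
Local Open Scope classical_set_scope.
Local Open Scope ring_scope.

#[local] Instance ae_lebesgue_filter {R : realType} :
  Filter (almost_everywhere (@lebesgue_measure R)).
Proof. exact: ae_filter_ringOfSetsType. Qed.

(** * The fundamental theorem of calculus for absolutely continuous functions *)

Section absolutely_continuous_ftc.
Context {R : realType}.
Local Notation mu := (@lebesgue_measure R).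
Implicit Types (f g h H : R -> R) (a b d e u v x : R).

Lemma is_derive_primitive H a x : continuous H -> a < x ->
  is_derive x 1 (fun y => \int[mu]_(t in `[a, y]) H t) (H x).
Proof.
move=> cH ax; have x_lt : x < x + 1 by rewrite ltrDl.
have iH : mu.-integrable `[a, x + 1] (EFin \o H).
  apply: continuous_compact_integrable; first exact: segment_compact.
  exact: continuous_subspaceT.
have [dF F'] := continuous_FTC1_closed x_lt iH ax (cH x).
by apply: DeriveDef => //; rewrite -derive1E.
Qed.

Lemma continuous_difference_quotient H e : continuous H ->
  continuous (fun x => e^-1 * (H (x + e) - H x)).
Proof.
move=> cH x; apply: cvgM; first exact: cvg_cst.
apply: cvgB; last exact: cH.
apply: (@continuous_comp _ _ _ (fun y => y + e) H); last exact: cH.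
by apply: cvgD; [exact: cvg_id|exact: cvg_cst].
Qed.

(* The integral is the difference of the means of H over [b, b + e] and over
   [a, a + e]. *)
Lemma integral_difference_quotient_le H a b e : 0 < e -> a < b ->
  continuous H -> {homo H : x y / x <= y} -> (forall x, b <= x -> H x = H b) ->
  (\int[mu]_(x in `[a, b]) (e^-1 * (H (x + e) - H x))%:E <= (H b - H a)%:E)%E.
Proof.
move=> e0 ab cH ndH Hb.
pose W y := \int[mu]_(t in `[a - 1, y]) H t.
have dW x : a - 1 < x -> is_derive x 1 W (H x) by exact: is_derive_primitive.
pose V x := e^-1 * (W (x + e) - W x).
have dV x : a - 1 < x -> is_derive x 1 V (e^-1 * (H (x + e) - H x)).
  move=> ax; have dWx := dW _ ax.
  have dWe : is_derive (x + e) 1 W (H (x + e)) by apply: dW; lra.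
  have dWs := @is_derive1_comp _ W (shift e) x _ _ dWe (is_derive_shift x 1 e).
  by apply: is_derive_eq; rewrite mulr1.
have mean_value u : a <= u -> exists2 c, u <= c & V u = H c.
  move=> au; have [|x||c] := @MVT _ W H u (u + e).
  - by rewrite ltrDl.
  - by rewrite in_itv/= => /andP[ux _]; apply: dW; lra.
  - apply: derivable_within_continuous => x; rewrite in_itv/= => /andP[ux _].
    by have [] : is_derive x 1 W (H x) by apply: dW; lra.
  - rewrite in_itv/= => /andP[/ltW uc _] WE; exists c => //.
    by rewrite /V WE addrAC subrr add0r mulrC mulfK ?gt_eqF.
have cV x : a <= x -> {for x, continuous V}.
  move=> ax; have [dVx _] : is_derive x 1 V (e^-1 * (H (x + e) - H x)).
    by apply: dV; lra.
  exact/differentiable_continuous/derivable1_diffP.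
rewrite (@continuous_FTC2 _ _ V)//.
- rewrite -EFinB lee_fin.
  have [cb bcb ->] := mean_value b (ltW ab).
  by have [ca aca ->] := mean_value a (lexx a); rewrite lerB ?(Hb _ bcb)// ndH.
- exact/continuous_subspaceT/continuous_difference_quotient.
- split; last 2 first.
  + exact/cvg_at_right_filter/cV.
  + exact/cvg_at_left_filter/cV/ltW.
  move=> x; rewrite in_itv/= => /andP[ax _].
  by have [] : is_derive x 1 V (e^-1 * (H (x + e) - H x)) by apply: dV; lra.
- move=> x; rewrite in_itv/= => /andP[ax _]; rewrite derive1E.
  by have [] : is_derive x 1 V (e^-1 * (H (x + e) - H x)) by apply: dV; lra.
Qed.

Lemma cvg_difference_quotient H x d : is_derive x 1 H d ->
  n.+1%:R * (H (x + n.+1%:R^-1) - H x) @[n --> \oo] --> d.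
Proof.
case=> dH <-; have /cvgr_dnbhsP : (t^-1 *: (H (t *: 1 + x) - H x))
  @[t --> 0^'] --> 'D_1 H x by exact: dH.
move=> /(_ (fun n => n.+1%:R^-1)) /= Hx.
under eq_fun => n do
  rewrite -[X in X * _]invrK [x + _]addrC -[X in H (X + x)]mulr1.
by apply: Hx; split=> [n|]; [rewrite invr_neq0|exact: cvg_harmonic].
Qed.

Lemma ae_itv_oo_cc a b (Q : R -> Prop) :
  {ae mu, forall x, x \in `]a, b[ -> Q x} ->
  {ae mu, forall x, x \in `[a, b] -> Q x}.
Proof.
have ae_neq c : {ae mu, forall x, x != c}.
  exists [set c]; split; [exact: measurable_set1|exact: lebesgue_measure_set1|].
  by move=> x /= /negP; rewrite negbK => /eqP.
move=> Qx; apply: filterS3 Qx (ae_neq a) (ae_neq b) => x Qx xa xb.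
by rewrite in_itv/= !le_eqVlt eq_sym (negbTE xa) (negbTE xb); exact: Qx.
Qed.

(* Fatou's lemma applied to the difference quotients of H. *)
Lemma nondecreasing_integral_normr_derive_le H h a b : a < b -> continuous H ->
  {homo H : x y / x <= y} -> (forall x, b <= x -> H x = H b) ->
  measurable_fun `[a, b] h ->
  {ae mu, forall x, x \in `]a, b[ -> is_derive x 1 H (h x)} ->
  (\int[mu]_(x in `[a, b]) `|(h x)%:E| <= (H b - H a)%:E)%E.
Proof.
move=> ab cH ndH Hb mh /ae_itv_oo_cc H'h.
pose Q n x := n.+1%:R * (H (x + n.+1%:R^-1) - H x).
have mQ n : measurable_fun `[a, b] (fun x => (Q n x)%:E).
  apply/measurable_EFinP; apply: subspace_continuous_measurable_fun => //.
  have := continuous_difference_quotient (e := n.+1%:R^-1) cH; rewrite invrK.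
  exact: continuous_subspaceT.
have Q0 n x : (0 <= (Q n x)%:E)%E.
  by rewrite lee_fin mulr_ge0// subr_ge0 ndH// lerDl.
rewrite (@ae_eq_integral _ _ _ mu `[a, b]
  (fun x => limn_einf (fun n => (Q n x)%:E)))//; last 3 first.
- by apply: measurableT_comp => //; exact/measurable_EFinP.
- under eq_fun do rewrite /limn_einf.
  apply: measurableT_comp => //; apply: measurable_fun_limn_esup => n.
  by apply: measurableT_comp => //; exact: mQ.
- apply: filterS H'h.
  move=> x /[apply] /cvg_difference_quotient Qh.
  have [|-> //] := @cvg_limn_einf_sup _ (fun n => (Q n x)%:E) `|(h x)%:E|.
  under eq_fun => n do rewrite -[(Q n x)%:E]gee0_abs//.
  by apply: cvg_abse; apply: cvg_EFin => //; exact: nearW.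
apply: le_trans (@fatou _ _ _ mu `[a, b] _ (fun n x => (Q n x)%:E) _ _) _ => //.
rewrite limn_einf_lim; apply: lime_le; first exact: is_cvg_einfs.
apply: nearW => n.
apply: (@le_trans _ _ (\int[mu]_(x in `[a, b]) (Q n x)%:E)%E).
  by apply: ereal_inf_lbound; exists n => /=.
have := @integral_difference_quotient_le H a b n.+1%:R^-1 _ ab cH ndH Hb.
by rewrite invrK; apply.
Qed.

Definition clamp a b : R -> R := cst a \max (id \min cst b).

Lemma clampP a b x : a <= b -> a <= clamp a b x <= b.
Proof.
by move=> ab; rewrite /clamp le_max lexx/= ge_max ab ge_min lexx orbT.
Qed.

Lemma clamp_id a b x : a <= x <= b -> clamp a b x = x.
Proof. by move=> /andP[ax xb]; rewrite /clamp/= min_l// max_r. Qed.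

Lemma clamp_homo a b : {homo clamp a b : x y / x <= y}.
Proof.
move=> x y xy; rewrite /clamp/= ge_max !le_max lexx/= !le_min !ge_min lexx xy.
by rewrite /= orbT orbT.
Qed.

Lemma continuous_clamp a b : continuous (clamp a b).
Proof.
move=> x; apply: continuous_max; first exact: cvg_cst.
by apply: continuous_min; [exact: cvg_id|exact: cvg_cst].
Qed.

Lemma continuous_comp_clamp f a b : a <= b -> {within `[a, b], continuous f} ->
  continuous (f \o clamp a b).
Proof.
move=> ab /subspace_continuousP cf x.
have cab y : `[a, b]%classic (clamp a b y) by rewrite /= in_itv/= clampP.
apply: (cvg_comp (clamp a b) f) (cf _ (cab x)).
move=> A /= wA; have := @continuous_clamp a b x _ wA.
by apply: (@filterS _ (nbhs x)) => y; apply; exact: cab.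
Qed.

Lemma is_derive_comp_clamp f a b x d : x \in `]a, b[ ->
  is_derive x 1 f d -> is_derive x 1 (f \o clamp a b) d.
Proof.
rewrite in_itv/= => /andP[ax xb]; apply: near_eq_is_derive => //.
near=> y; rewrite /= clamp_id//; apply/andP; split; near: y.
- by apply: filterS (lt_nbhsr ax) => y; exact: ltW.
- by apply: filterS (lt_nbhsl xb) => y; exact: ltW.
Unshelve. all: by end_near. Qed.

Lemma nondecreasing_integral_derive_le H h a b : a < b ->
  {within `[a, b], continuous H} -> {in `[a, b] &, {homo H : x y / x <= y}} ->
  measurable_fun `[a, b] h ->
  {ae mu, forall x, x \in `]a, b[ -> is_derive x 1 H (h x)} ->
  mu.-integrable `[a, b] (EFin \o h) /\
  \int[mu]_(x in `[a, b]) h x <= H b - H a.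
Proof.
move=> ab cH ndH mh H'h.
have clamp_in x : clamp a b x \in `[a, b] by rewrite in_itv/= clampP// ltW.
have h_le : (\int[mu]_(x in `[a, b]) `|(h x)%:E| <= (H b - H a)%:E)%E.
  rewrite (_ : H b - H a = (H \o clamp a b) b - (H \o clamp a b) a); last first.
    by rewrite /= !clamp_id ?lexx ?ltW.
  apply: nondecreasing_integral_normr_derive_le => //.
  - exact: continuous_comp_clamp (ltW ab) cH.
  - by move=> x y xy; apply: ndH; rewrite ?clamp_homo.
  - by move=> x bx; rewrite /clamp/= minxx min_r.
  - apply: filterS H'h.
    by move=> x Hx xab; apply: is_derive_comp_clamp => //; exact: Hx.
have ih : mu.-integrable `[a, b] (EFin \o h).
  apply/integrableP; split; first exact/measurable_EFinP.
  by rewrite (le_lt_trans h_le)// ltry.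
split=> //; rewrite -lee_fin (le_trans _ h_le)//.
rewrite /Rintegral fineK; last exact: integrable_fin_num.
rewrite (le_trans (lee_abs _))// le_abse_integral//.
exact: measurable_int ih.
Qed.

Lemma integrable_subitv (f : R -> \bar R) a b u v : a <= u -> v <= b ->
  mu.-integrable `[a, b] f -> mu.-integrable `[u, v] f.
Proof.
move=> au vb; apply: integrableS => //.
by apply: subset_itv; rewrite bnd_simp.
Qed.

Lemma Rintegral_itv_increment g a u v : a <= u -> u <= v ->
  mu.-integrable `[a, v] (EFin \o g) ->
  \int[mu]_(x in `[u, v]) g x =
  \int[mu]_(x in `[a, v]) g x - \int[mu]_(x in `[a, u]) g x.
Proof.
move=> au uv ig; rewrite Rintegral_itvB// Rintegral_itv_obnd_cbnd//.
by apply: integrableS ig => //; apply: subset_itvr; rewrite bnd_simp.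
Qed.

Lemma ae_is_derive_integral g a b : a < b ->
  mu.-integrable `[a, b] (EFin \o g) ->
  {ae mu, forall x, x \in `]a, b[ ->
    is_derive x 1 (fun y => \int[mu]_(t in `[a, y]) g t) (g x)}.
Proof.
move=> ab ig; pose gab := g \_ `[a, b].
have igab : mu.-integrable setT (EFin \o gab).
  by move: ig; rewrite integrable_mkcond//= restrict_EFin.
have /FTC1 : forall y,
    mu.-integrable [set` Interval (BLeft a) (BRight y)] (EFin \o gab).
  by move=> y; apply: integrableS igab.
move=> /(_ (integrable_locally _ ig)) /= => /(_ (measurable_itv _)).
apply: filterS => x /= dx; rewrite in_itv/= => /andP[ax xb].
have [|d1 d2] := dx; first by [].
have : is_derive x 1 (fun x => \int[mu]_(t in `[a, x]) gab t) (g x).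
  apply: DeriveDef => //; rewrite -derive1E d2 /gab patchE mem_set//= in_itv/=.
  by rewrite !ltW.
apply: near_eq_is_derive => //; near=> y.
apply: eq_Rintegral => z; rewrite inE/= in_itv/= => /andP[az zy].
rewrite /gab patchE mem_set//= in_itv/= az/= (le_trans zy)//.
by near: y; apply: filterS (lt_nbhsl xb) => y; exact: ltW.
Unshelve. all: by end_near. Qed.

Definition dominated_by g a b f := forall u v, a <= u -> u <= v -> v <= b ->
  `|f v - f u| <= \int[mu]_(x in `[u, v]) g x.

Lemma dominated_by_increment g a b f u v : mu.-integrable `[a, b] (EFin \o g) ->
  dominated_by g a b f -> a <= u -> u <= v -> v <= b ->
  `|f v - f u| <=
    \int[mu]_(x in `[a, v]) g x - \int[mu]_(x in `[a, u]) g x.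
Proof.
move=> ig fg au uv vb; rewrite (le_trans (fg _ _ au uv vb))//.
by rewrite (Rintegral_itv_increment au)//; apply: integrable_subitv ig.
Qed.

Lemma dominated_by_within_continuous g a b f : a <= b ->
  mu.-integrable `[a, b] (EFin \o g) -> dominated_by g a b f ->
  {within `[a, b], continuous f}.
Proof.
move=> ab ig fg; apply/subspace_continuousP => x xab.
pose G x := \int[mu]_(t in `[a, x]) g t.
have /subspace_continuousP/(_ x xab)/cvgrPdist_lt cG :
  {within `[a, b], continuous G} by exact: parameterized_integral_continuous.
apply/cvgrPdist_lt => e e0; near=> y.
have : `|G x - G y| < e by near: y; exact: cG.
have : y \in `[a, b] by near: y; exact: withinT.
move: xab; rewrite /= !in_itv/= => /andP[ax xb] /andP[ay yb].
apply: le_lt_trans; rewrite /from_subspace.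
have [xy|/ltW yx] := leP x y.
  rewrite distrC [leRHS]distrC.
  by rewrite (le_trans (dominated_by_increment ig fg ax xy yb))// ler_norm.
by rewrite (le_trans (dominated_by_increment ig fg ay yx xb))// ler_norm.
Unshelve. all: by end_near. Qed.

Lemma dominated_by_integral_derive_le g a b f h : a < b ->
  mu.-integrable `[a, b] (EFin \o g) -> dominated_by g a b f ->
  measurable_fun `[a, b] h ->
  {ae mu, forall x, x \in `]a, b[ -> is_derive x 1 f (h x)} ->
  mu.-integrable `[a, b] (EFin \o h) /\
  \int[mu]_(x in `[a, b]) h x <= f b - f a.
Proof.
move=> ab ig fg mh f'h.
pose G x := \int[mu]_(t in `[a, x]) g t.
have [||||igh] := @nondecreasing_integral_derive_le (G \+ f) (g \+ h) a b ab.
- move=> x; apply: cvgD.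
    exact: (parameterized_integral_continuous (ltW ab)).
  exact: dominated_by_within_continuous (ltW ab) ig fg _.
- move=> x y; rewrite !in_itv/= => /andP[ax _] /andP[_ yb] xy.
  have := dominated_by_increment ig fg ax xy yb.
  by rewrite ler_norml => /andP[+ _]; rewrite /G/=; lra.
- apply: measurable_funD => //.
  by apply/measurable_EFinP; exact: measurable_int ig.
- apply: filterS2 (ae_is_derive_integral ab ig) f'h => x G' f' xab.
  have := f' xab; have := G' xab => ? ?; exact: is_deriveD.
have ih : mu.-integrable `[a, b] (EFin \o h).
  apply: (eq_integrable _ _ _ _ (integrableB _ igh ig)) => //= x _.
  by rewrite -EFinB addrC addKr.
rewrite RintegralD// /G/= set_itv1 Rintegral_set1 => le_int; split=> //.
by move: le_int; lra.
Qed.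

Theorem dominated_by_ftc g a b f h : a < b ->
  mu.-integrable `[a, b] (EFin \o g) -> dominated_by g a b f ->
  measurable_fun `[a, b] h ->
  {ae mu, forall x, x \in `]a, b[ -> is_derive x 1 f (h x)} ->
  mu.-integrable `[a, b] (EFin \o h) /\
  \int[mu]_(x in `[a, b]) h x = f b - f a.
Proof.
move=> ab ig fg mh f'h.
have [ih h_le] := dominated_by_integral_derive_le ab ig fg mh f'h.
have [|||_] := @dominated_by_integral_derive_le g a b (\- f) (\- h) ab ig.
- by move=> u v au uv vb; rewrite /= -opprD normrN; exact: fg.
- exact: measurable_funN.
- apply: filterS f'h.
  by move=> x f' xab; have := f' xab => ?; exact: is_deriveN.
rewrite (_ : \int[mu]_(x in `[a, b]) (\- h) x = - \int[mu]_(x in `[a, b]) h x).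
  move=> /= h_ge; split=> //; apply/le_anti; rewrite h_le -lerN2 opprB /=.
  by rewrite (le_trans h_ge)// opprK addrC.
rewrite -mulN1r -RintegralZl//; apply: eq_Rintegral => x _.
by rewrite mulN1r.
Qed.

End absolutely_continuous_ftc.

(** * Series with nonnegative terms *)

Section nonnegative_series.
Context {R : realType}.
Implicit Types (a b u : nat -> R) (f : nat -> R -> \bar R).

Lemma EFin_limn_series a : cvgn (series a) ->
  ((limn (series a))%:E = \sum_(k <oo) (a k)%:E)%E.
Proof.
move=> ca; rewrite -EFin_lim//; congr (limn _); apply/funext => n /=.
by rewrite sumEFin.
Qed.

Lemma nnseries_cvgP a : (forall k, 0 <= a k) ->
  cvgn (series a) <-> (\sum_(k <oo) (a k)%:E < +oo)%E.
Proof.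
move=> a0; split=> [ca|]; last exact: nnseries_is_cvg.
by rewrite -EFin_limn_series// ltry.
Qed.

(* Both sides take the junk value 0 when the series diverges. *)
Lemma limn_nnseries a : (forall k, 0 <= a k) ->
  limn (series a) = fine (\sum_(k <oo) (a k)%:E)%E.
Proof.
move=> a0; have [ca|dvg] := pselect (cvgn (series a)).
  by rewrite -EFin_limn_series.
rewrite dvgP//; have /negP := contra_not (nnseries_cvgP a0).2 dvg.
by rewrite -leNgt leye_eq => /eqP ->.
Qed.

Lemma cvg_series_shiftS u :
  cvgn (series (fun k => u k.+1)) <-> cvgn (series u).
Proof.
have uS n : series u n.+1 = u 0%N + series (fun k => u k.+1) n.
  by rewrite /series/= big_nat_recl.
split=> /cvg_ex[l ul]; apply/cvg_ex.
  exists (u 0%N + l); rewrite -(cvg_shiftS (series u)).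
  by under eq_fun do rewrite uS; apply: cvgD; [exact: cvg_cst|exact: ul].
exists (l - u 0%N).
rewrite (_ : series _ = fun n => series u n.+1 - u 0%N); last first.
  by apply/funext => n; rewrite uS addrC addKr.
by apply: cvgB; [rewrite (cvg_shiftS (series u))|exact: cvg_cst].
Qed.

Lemma limn_series_single (k : nat) (c : R) :
  limn (series (fun j => (j == k)%:R * c)) = c.
Proof.
apply/cvg_lim => //; have : (fun _ : nat => c) @ \oo --> c by exact: cvg_cst.
apply: cvg_trans; apply: near_eq_cvg; exists k.+1 => // n /= kn.
rewrite /series/= (bigD1_seq k) ?mem_index_iota ?iota_uniq ?kn//= eqxx mul1r.
by rewrite big1 ?addr0// => j /negbTE ->; rewrite mul0r.
Qed.

Lemma nneseries_antidiagonal (w : nat -> nat -> \bar R) :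
  (forall i j, (0 <= w i j)%E) ->
  (\sum_(k <oo) \sum_(i < k.+1) w i (k - i)%N =
   \sum_(i <oo) \sum_(j <oo) w i j)%E.
Proof.
move=> w0; pose v i k : \bar R := if (i <= k)%N then w i (k - i)%N else 0%E.
have v0 i k : (0 <= v i k)%E by rewrite /v; case: ifP.
transitivity (\sum_(k <oo) \sum_(i <oo) v i k)%E.
  apply: eq_eseriesr => k _; rewrite (@nneseries_split _ _ 0 k.+1)// add0n.
  rewrite [X in (_ + X)%E]eseries0 ?adde0; last first.
    by move=> i ki _; rewrite /v leqNgt ki.
  by rewrite big_mkord; apply: eq_bigr => i _; rewrite /v -ltnS ltn_ord.
rewrite nneseries_interchange//; apply: eq_eseriesr => i _.
rewrite (@nneseries_split _ _ 0 i)// add0n big_nat_cond big1 ?add0e; last first.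
  by move=> k /andP[/andP[_ ki] _]; rewrite /v leqNgt ki.
rewrite -(nneseries_addn i)//.
by apply: eq_eseriesr => j _; rewrite /v leq_addl addnK.
Qed.

Definition first_moment a : \bar R := (\sum_(k <oo) (k%:R * a k)%:E)%E.

Lemma first_moment_ge0 a : (forall k, 0 <= a k) -> (0 <= first_moment a)%E.
Proof.
by move=> a0; apply: nneseries_ge0 => k _ _; rewrite lee_fin mulr_ge0.
Qed.

Lemma first_moment_convolution a b :
  (forall k, 0 <= a k) -> (forall k, 0 <= b k) ->
  (\sum_(k <oo) (a k)%:E = 1)%E -> (\sum_(k <oo) (b k)%:E = 1)%E ->
  first_moment (fun k => \sum_(i < k.+1) a i * b (k - i)%N) =
  (first_moment a + first_moment b)%E.
Proof.
move=> a0 b0 a1 b1; rewrite /first_moment.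
pose w i j : \bar R := ((i + j)%:R * (a i * b j))%:E.
have ab0 i j (c : nat) : (0 <= (c%:R * (a i * b j))%:E)%E.
  by rewrite lee_fin !mulr_ge0.
transitivity (\sum_(k <oo) \sum_(i < k.+1) w i (k - i)%N)%E.
  apply: eq_eseriesr => k _; rewrite mulr_sumr -sumEFin; apply: eq_bigr => i _.
  by rewrite /w subnKC// -ltnS.
rewrite nneseries_antidiagonal; last by move=> i j; exact: ab0.
transitivity (\sum_(i <oo) (\sum_(j <oo) (i%:R * (a i * b j))%:E +
                            \sum_(j <oo) (j%:R * (a i * b j))%:E))%E.
  apply: eq_eseriesr => i _; rewrite -nneseriesD//.
  by apply: eq_eseriesr => j _; rewrite /w natrD mulrDl EFinD.
rewrite nneseriesD//; [|by move=> i _ _; exact: nneseries_ge0..].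
congr (_ + _)%E; last rewrite nneseries_interchange//.
- apply: eq_eseriesr => i _; under eq_eseriesr do rewrite mulrA EFinM.
  by rewrite nneseriesZl ?b1 ?mule1// => j _; rewrite lee_fin.
- apply: eq_eseriesr => j _.
  under eq_eseriesr do rewrite [a _ * _]mulrC mulrA EFinM.
  by rewrite nneseriesZl ?a1 ?mule1// => i _; rewrite lee_fin.
Qed.

Lemma nondecreasing_at_left_cvge (f : R -> \bar R) (c p : R) : c < p ->
  {in `]c, p[ &, {homo f : x y / x <= y >-> (x <= y)%E}} ->
  f x @[x --> p^'-] --> ereal_sup (f @` `]c, p[).
Proof.
move=> cp ndf; have oppI x : (- x \in `]c, p[) = (x \in `](- p), (- c)[).
  by rewrite !in_itv/= ltrNr ltrNl andbC.
have -> : f @` `]c, p[ = (f \o -%R) @` `](- p), (- c)[.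
  apply/seteqP; split=> _ [x xcp <-].
    by exists (- x); rewrite /= ?opprK// -oppI opprK.
  by exists (- x) => //; rewrite /= oppI.
apply/cvg_at_leftNP; apply: nonincreasing_at_right_cvge.
  by rewrite bnd_simp ltrN2.
by move=> x y; rewrite -!oppI => xcp ycp xy; apply: ndf; rewrite ?lerN2.
Qed.

Lemma nneseries_cvg_at_left f (l : nat -> \bar R) (c p : R) : c < p ->
  (forall k x, x \in `]c, p[ -> (0 <= f k x)%E) ->
  (forall k, {in `]c, p[ &, {homo f k : x y / x <= y >-> (x <= y)%E}}) ->
  (forall k, f k x @[x --> p^'-] --> l k) ->
  (\sum_(k <oo) f k x)%E @[x --> p^'-] --> (\sum_(k <oo) l k)%E.
Proof.
move=> cp f0 ndf fl.
have near_cp : \forall x \near p^'-, x \in `]c, p[.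
  by near=> x; rewrite in_itv/=; apply/andP; split; near: x;
    [exact: nbhs_left_gt|exact: nbhs_left_lt].
have f_le k x : x \in `]c, p[ -> (f k x <= l k)%E.
  move=> xcp; apply: cvge_to_ge (fl k) _; near=> y; apply: ndf => //.
    by near: y.
  by near: y; apply: nbhs_left_ge; move: xcp; rewrite in_itv/= => /andP[].
have sum_homo : {in `]c, p[ &,
    {homo (fun x => \sum_(k <oo) f k x)%E : x y / x <= y >-> (x <= y)%E}}.
  move=> x y xcp ycp xy.
  by apply: lee_nneseries => [k _ _|k _]; [exact: f0|exact: ndf].
have sum_cvg := nondecreasing_at_left_cvge cp sum_homo.
suff <- : (ereal_sup [set \sum_(k <oo) f k x | x in `]c, p[] =
  \sum_(k <oo) l k)%E by [].
apply/le_anti/andP; split.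
  apply: ge_ereal_sup => _ [x xcp <-].
  by apply: lee_nneseries => [k _ _|k _]; [exact: f0|exact: f_le].
apply: lime_le.
  apply: is_cvg_nneseries => k _ _.
  by apply: cvge_to_ge (fl k) _; near=> x; apply: f0; near: x.
apply: nearW => n; apply: (lee_cvg_to (cvg_nnesum _ (fun k _ => fl k)) sum_cvg).
  by move=> k _; near=> x; apply: f0; near: x.
near=> x; apply: nneseries_lim_ge => k _ _; apply: f0; near: x; exact: near_cp.
Unshelve. all: by end_near. Qed.

End nonnegative_series.

(** * Generating functions with nonnegative coefficients *)

Section generating_function.
Context {R : realType}.
Implicit Types (a : nat -> R) (x y : R).

Definition gf a x : R := limn (pseries a x).

Lemma pseries1 a : pseries a 1 = series a.
Proof.
by rewrite /pseries; congr series; apply/funext => k /=; rewrite expr1n mulr1.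
Qed.

Lemma gf1 a : gf a 1 = limn (series a).
Proof. by rewrite /gf pseries1. Qed.

Lemma gf_recl a x : cvgn (pseries (fun k => a k.+1) x) ->
  gf a x = a 0%N + x * gf (fun k => a k.+1) x.
Proof.
move=> ca; apply/cvg_lim => //; rewrite -(cvg_shiftS (pseries a x)).
have aS n : pseries a x n.+1 = a 0%N + x * pseries (fun k => a k.+1) x n.
  rewrite /pseries/series/= big_nat_recl// mulr1 mulr_sumr; congr (_ + _).
  by apply: eq_bigr => k _; rewrite exprS mulrCA.
under eq_fun do rewrite aS.
by apply: cvgD; [exact: cvg_cst|apply: cvgM; [exact: cvg_cst|exact: ca]].
Qed.

Lemma near_left1 : \forall x \near (1 : R)^'-, 0 < x < 1.
Proof.
near=> x; apply/andP; split; near: x; last exact: nbhs_left_lt.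
by apply: nbhs_left_gt; exact: ltr01.
Unshelve. all: by end_near. Qed.

Lemma eq_cvg_left1 (T : topologicalType) (f g : R -> T) (l : T) :
  (forall x, 0 < x < 1 -> g x = f x) ->
  f x @[x --> 1^'-] --> l -> g x @[x --> 1^'-] --> l.
Proof.
move=> gf; apply: cvg_trans; apply: near_eq_cvg.
by apply: filterS near_left1 => x /gf.
Qed.

Section nonnegative_coefficients.
Variable a : nat -> R.
Hypothesis a0 : forall k, 0 <= a k.

Let term_ge0 x k : 0 <= x -> 0 <= a k * x ^+ k.
Proof. by move=> x0; rewrite mulr_ge0// exprn_ge0. Qed.

Lemma cvg_nnpseries x y : 0 <= x <= y ->
  cvgn (pseries a y) -> cvgn (pseries a x).
Proof.
move=> /andP[x0 xy]; apply: series_le_cvg => k; [exact: term_ge0| |].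
  by rewrite term_ge0// (le_trans x0).
by rewrite ler_wpM2l// lerXn2r// nnegrE (le_trans x0).
Qed.

Lemma EFin_gf x : cvgn (pseries a x) ->
  ((gf a x)%:E = \sum_(k <oo) (a k * x ^+ k)%:E)%E.
Proof. exact: EFin_limn_series. Qed.

Lemma gf_homo x y : 0 <= x <= y -> cvgn (pseries a y) -> gf a x <= gf a y.
Proof.
move=> /andP[x0 xy] cy; apply: lim_series_le => //.
  by apply: cvg_nnpseries cy; rewrite x0.
by move=> k; rewrite ler_wpM2l// lerXn2r// nnegrE (le_trans x0).
Qed.

Lemma gf_ge0 x : 0 <= x -> cvgn (pseries a x) -> 0 <= gf a x.
Proof.
move=> x0 cx; apply: limr_ge => //; apply: nearW => n.
by apply: sumr_ge0 => k _; exact: term_ge0.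
Qed.

(* Since (k + 1) x^k (y - x) <= y^(k + 1), the derived series converges. *)
Lemma cvg_pseries_diffs x y : 0 <= x < y -> cvgn (pseries a y) ->
  cvgn (pseries (pseries_diffs a) x).
Proof.
move=> /andP[x0 xy] cy; have y0 : 0 <= y by rewrite (le_trans x0)// ltW.
have yx : 0 < y - x by rewrite subr_gt0.
apply: (@series_le_cvg _ _ (fun k => (y - x)^-1 * (a k.+1 * y ^+ k.+1))).
- by move=> k; rewrite !mulr_ge0// exprn_ge0.
- by move=> k; rewrite mulr_ge0 ?invr_ge0 ?(ltW yx)// mulr_ge0// exprn_ge0.
- move=> k; rewrite /pseries_diffs/= mulrAC [leRHS]mulrCA mulrC ler_wpM2l//.
  rewrite ler_pdivlMl// (@le_trans _ _ (y ^+ k.+1 - x ^+ k.+1))//; last first.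
    by rewrite gerBl exprn_ge0.
  rewrite subrXX ler_wpM2l ?(ltW yx)// mulr_natl -[k.+1 in leLHS]card_ord.
  rewrite -sumr_const; apply: ler_sum => i _; rewrite /= ?subSS.
  rewrite -[in leLHS](subnK (ltn_ord i : (i <= k)%N)) exprD.
  by rewrite ler_wpM2r ?exprn_ge0// lerXn2r// ?nnegrE// ltW.
- by apply: is_cvg_seriesZ; apply/(cvg_series_shiftS (fun k => a k * y ^+ k)).
Qed.

Lemma pseries_diffs_ge0 k : 0 <= pseries_diffs a k.
Proof. by rewrite mulr_ge0. Qed.

End nonnegative_coefficients.

Lemma is_derive_gf a x y : (forall k, 0 <= a k) -> 0 <= x < y ->
  cvgn (pseries a y) -> is_derive x 1 (gf a) (gf (pseries_diffs a) x).
Proof.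
move=> a0 /andP[x0 xy] cy; pose z := (x + y) / 2; pose w := (z + y) / 2.
have cz : cvgn (pseries a z) by apply: cvg_nnpseries cy => //; rewrite /z; lra.
have cdw : cvgn (pseries (pseries_diffs a) w).
  by apply: cvg_pseries_diffs cy => //; rewrite /w /z; lra.
have cdz : cvgn (pseries (pseries_diffs a) z).
  by apply: cvg_pseries_diffs cy => //; rewrite /z; lra.
apply: (pseries_snd_diffs cz cdz); last by rewrite !ger0_norm// /z; lra.
apply: cvg_pseries_diffs cdw; first exact: pseries_diffs_ge0.
by rewrite /w /z; lra.
Qed.

Lemma gf_cvg_left1 a : (forall k, 0 <= a k) ->
  (forall x, 0 <= x < 1 -> cvgn (pseries a x)) ->
  (gf a x)%:E @[x --> 1^'-] --> (\sum_(k <oo) (a k)%:E)%E.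
Proof.
move=> a0 ca.
apply: (eq_cvg_left1 (f := fun x => \sum_(k <oo) (a k * x ^+ k)%:E)%E).
  by move=> x /andP[x0 x1]; rewrite EFin_gf//; apply: ca; rewrite ltW.
apply: (@nneseries_cvg_at_left _ _ _ 0) => [|k x|k x y|k]; rewrite ?ltr01//.
- rewrite in_itv/= => /andP[x0 _].
  by rewrite lee_fin mulr_ge0// exprn_ge0// ltW.
- rewrite !in_itv/= => /andP[x0 _] /andP[y0 _] xy.
  by rewrite lee_fin ler_wpM2l// lerXn2r// nnegrE ltW.
- apply: cvg_EFin; first exact: nearW; apply: cvg_at_left_filter.
  have akE : a k = a k * 1 ^+ k by rewrite expr1n mulr1.
  rewrite [X in _ --> X]akE.
  by apply: cvgM; [exact: cvg_cst|exact: exprn_continuous].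
Qed.

Lemma cvg_summable_pseries a x : (forall k, 0 <= a k) -> cvgn (series a) ->
  0 <= x <= 1 -> cvgn (pseries a x).
Proof.
by move=> a0 ca x01; apply: cvg_nnpseries x01 _ => //; rewrite pseries1.
Qed.

Section summable_coefficients.
Variable a : nat -> R.
Hypotheses (a0 : forall k, 0 <= a k) (ca : cvgn (series a)).

Lemma gf_ge_affine x : 0 <= x <= 1 -> a 0%N + a 1%N * x <= gf a x.
Proof.
move=> /andP[x0 x1].
have -> : a 0%N + a 1%N * x = pseries a x 2.
  by rewrite /pseries/series/= !big_nat_recr//= big_nil add0r expr0 mulr1 expr1.
apply: nondecreasing_cvgn_le; last first.
  by apply: cvg_summable_pseries => //; rewrite x0.
by apply: nondecreasing_series => k _ _; rewrite mulr_ge0// exprn_ge0.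
Qed.

Lemma gf_le_quadratic x : 0 <= x <= 1 ->
  gf a x <= a 0%N + a 1%N * x + (gf a 1 - a 0%N - a 1%N) * x ^+ 2.
Proof.
move=> /andP[x0 x1]; pose b k := a k.+1; pose c k := a k.+2.
have cb : cvgn (series b) by apply/cvg_series_shiftS.
have cc : cvgn (series c) by apply/(cvg_series_shiftS b).
have gfE y : 0 <= y <= 1 -> gf a y = a 0%N + y * (a 1%N + y * gf c y).
  move=> y01; rewrite (@gf_recl a) ?(@gf_recl b)//.
    by apply: cvg_summable_pseries => // k; exact: a0.
  by apply: cvg_summable_pseries => // k; exact: a0.
have gfc_le : gf c x <= gf c 1.
  by apply: gf_homo; [move=> k; exact: a0|rewrite x0|rewrite pseries1].
rewrite !gfE ?ler01 ?lexx ?x0//.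
rewrite -subr_ge0 [leRHS](_ : _ = x ^+ 2 * (gf c 1 - gf c x)); last by ring.
by rewrite mulr_ge0 ?exprn_ge0// subr_ge0.
Qed.

Lemma summable_gf_cvg_left1 : gf a x @[x --> 1^'-] --> gf a 1.
Proof.
have : (gf a x)%:E @[x --> 1^'-] --> (gf a 1)%:E.
  rewrite gf1 EFin_limn_series//; apply: gf_cvg_left1 => // x /andP[x0 x1].
  by apply: cvg_summable_pseries => //; rewrite x0 ltW.
by move=> /fine_cvgP[].
Qed.

Lemma summable_is_derive_gf x : 0 <= x < 1 ->
  is_derive x 1 (gf a) (gf (pseries_diffs a) x).
Proof. by move=> x01; apply: (is_derive_gf a0 x01); rewrite pseries1. Qed.

Lemma gf_diffs_cvg_left1 :
  (gf (pseries_diffs a) x)%:E @[x --> 1^'-] --> first_moment a.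
Proof.
rewrite /first_moment nneseries_recl//; last first.
  by move=> k _; rewrite lee_fin mulr_ge0.
rewrite mul0r add0e -(nneseries_addn 1); last first.
  by move=> k; rewrite lee_fin mulr_ge0.
under [X in _ --> X]eq_eseriesr do rewrite addn1.
apply: gf_cvg_left1 => [k|x x01]; first by rewrite mulr_ge0.
by apply: (cvg_pseries_diffs a0 x01); rewrite pseries1.
Qed.

End summable_coefficients.
End generating_function.

Section geometric_sum.
Context {R : realType}.
Implicit Types (k : nat) (x y : R).

Definition geosum k x : R := \sum_(i < k) x ^+ i.

Lemma geosum1 k : geosum k 1 = k%:R.
Proof.
rewrite /geosum; under eq_bigr do rewrite expr1n.
by rewrite sumr_const card_ord.
Qed.

Lemma mul_onem_geosum k x : (1 - x) * geosum k x = 1 - x ^+ k.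
Proof. by rewrite -opprB mulNr -subrX1 opprB. Qed.

Lemma geosum_ge0 k x : 0 <= x -> 0 <= geosum k x.
Proof. by move=> x0; apply: sumr_ge0 => i _; exact: exprn_ge0. Qed.

Lemma geosum_homo k x y : 0 <= x -> x <= y -> geosum k x <= geosum k y.
Proof.
move=> x0 xy; apply: ler_sum => i _.
by rewrite lerXn2r// nnegrE (le_trans x0).
Qed.

Lemma continuous_geosum k : continuous (geosum k).
Proof.
apply: continuous_big => [|i _]; first exact: add_continuous.
exact: exprn_continuous.
Qed.

End geometric_sum.

(** * Finite measures on the compactified state space *)

Section measure_N0s.
Context {R : realType}.
Implicit Types (mu nu : N0s -> R) (x y : R).

Definition N0s_mean mu : \bar R :=
  ((mu None)%:E * +oo + first_moment (mu \o Some))%E.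

(* The slope (mu(N_0^* ) - G(x)) / (1 - x), G being the generating function of a
   finite mu, in a form that is measurable in mu and monotone in x. *)
Definition secant mu x : \bar R :=
  ((mu None / (1 - x))%:E + \sum_(k <oo) (mu (Some k) * geosum k x)%:E)%E.

Lemma kint_indicator mu k : kint mu (fun m => (m == k)%:R) = mu k.
Proof.
case: k => [k|]; rewrite /kint /=.
  rewrite mulr0 add0r -[RHS](limn_series_single k); congr (limn (series _)).
  apply/funext => j; rewrite mulrC -[Some j == Some k]/(j == k).
  by case: eqP => [->//|]; rewrite !mul0r.
rewrite mulr1 (_ : series _ = fun=> 0) ?lim_cst ?addr0//.
by apply/funext => n; rewrite /series/= big1// => j _; rewrite mulr0.
Qed.

Section nonnegative_measure.
Variable mu : N0s -> R.
Hypothesis mu0 : forall m, 0 <= mu m.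

Let moment_ge0 : (0 <= first_moment (mu \o Some))%E.
Proof. by apply: first_moment_ge0 => k; exact: mu0. Qed.

Lemma N0s_mean_ge0 : (0 <= N0s_mean mu)%E.
Proof. by rewrite adde_ge0 ?moment_ge0// mule_ge0// lee_fin. Qed.

Lemma N0s_mean_None0 : mu None = 0 ->
  N0s_mean mu = first_moment (mu \o Some).
Proof. by rewrite /N0s_mean => ->; rewrite mul0e add0e. Qed.

Lemma N0s_mean_None_gt0 : 0 < mu None -> N0s_mean mu = +oo%E.
Proof.
move=> mu_gt0; rewrite /N0s_mean gt0_muley ?lte_fin// addye// gt_eqF//.
exact: lt_le_trans moment_ge0.
Qed.

Lemma N0s_mean_lty_None : (N0s_mean mu < +oo)%E -> mu None = 0.
Proof.
have := mu0 None; rewrite le_eqVlt => /predU1P[<-//|/N0s_mean_None_gt0 ->].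
by rewrite ltxx.
Qed.

Lemma secant_ge0 x : 0 <= x < 1 -> (0 <= secant mu x)%E.
Proof.
move=> /andP[x0 x1]; rewrite adde_ge0//.
  by rewrite lee_fin divr_ge0// subr_ge0 ltW.
by apply: nneseries_ge0 => k _ _; rewrite lee_fin mulr_ge0// geosum_ge0.
Qed.

Lemma secant_homo x y : 0 <= x -> x <= y -> y < 1 ->
  (secant mu x <= secant mu y)%E.
Proof.
move=> x0 xy y1; have x1 := le_lt_trans xy y1; apply: leeD.
  by rewrite lee_fin ler_wpM2l// lef_pV2 ?posrE ?subr_gt0// lerB.
apply: lee_nneseries => [k _ _|k _].
  by rewrite lee_fin mulr_ge0// geosum_ge0.
by rewrite lee_fin ler_wpM2l// geosum_homo.
Qed.

Lemma secant_cvg_left1 : secant mu x @[x --> 1^'-] --> N0s_mean mu.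
Proof.
apply: cvgeD.
- rewrite ge0_adde_def// inE ?moment_ge0// mule_ge0// lee_fin.
  exact: mu0.
- have := mu0 None; rewrite le_eqVlt => /predU1P[<-|mu_gt0].
    by rewrite mul0e; under eq_fun do rewrite mul0r; exact: cvg_cst.
  rewrite gt0_muley ?lte_fin//; apply/cvgeryP; apply: gt0_cvgMry => //.
  apply/cvgrVy.
    by near=> x; rewrite subr_gt0; near: x; exact: nbhs_left_lt.
  rewrite -(subrr (1 : R)); apply: cvgB; first exact: cvg_cst.
  by apply: cvg_at_left_filter; exact: cvg_id.
- rewrite /first_moment.
  apply: (@nneseries_cvg_at_left _ _ _ 0) => [|k x|k x y|k]; rewrite ?ltr01//.
  + rewrite in_itv/= => /andP[x0 _].
    by rewrite lee_fin mulr_ge0// geosum_ge0// ltW.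
  + rewrite !in_itv/= => /andP[x0 _] _ xy.
    by rewrite lee_fin ler_wpM2l// geosum_homo// ltW.
  + apply: cvg_EFin; first exact: nearW; apply: cvg_at_left_filter.
    rewrite mulrC -geosum1.
    by apply: cvgM; [exact: cvg_cst|exact: continuous_geosum].
Unshelve. all: by end_near. Qed.

Lemma secant_le_mean x : 0 <= x < 1 -> (secant mu x <= N0s_mean mu)%E.
Proof.
move=> /andP[x0 x1]; apply: cvge_to_ge secant_cvg_left1 _.
by near=> y; apply: secant_homo => //; near: y; exact: nbhs_left_ge.
Unshelve. all: by end_near. Qed.

Lemma secantE x : cvgn (series (mu \o Some)) -> 0 <= x < 1 ->
  secant mu x = ((mass mu - gf (mu \o Some) x) / (1 - x))%:E.
Proof.
move=> cmu /andP[x0 x1]; rewrite /secant.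
have x1_neq0 : 1 - x != 0 by rewrite subr_eq0 gt_eqF.
have cgf : cvgn (pseries (mu \o Some) x).
  apply: cvg_summable_pseries cmu _; first by move=> k; exact: mu0.
  by rewrite x0 ltW.
have : series (fun k => mu (Some k) * geosum k x) @ \oo -->
    (mass_fin mu - gf (mu \o Some) x) / (1 - x).
  rewrite (_ : series _ = fun n =>
    (series (mu \o Some) n - pseries (mu \o Some) x n) / (1 - x)).
    by apply: cvgM; [apply: cvgB|exact: cvg_cst].
  apply/funext => n; rewrite /pseries/series/= -sumrB mulr_suml.
  apply: eq_bigr => k _ /=; rewrite -[X in X - _]mulr1 -mulrBr -mul_onem_geosum.
  by field.
move=> cS; rewrite -EFin_limn_series; last by apply/cvg_ex; eexists; exact: cS.
by rewrite (cvg_lim _ cS)// -EFinD -mulrDl /mass addrA.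
Qed.

End nonnegative_measure.

Section probability_N0s.
Variable mu : N0s -> R.
Hypothesis pmu : is_prob mu.

Lemma is_prob_ge0 m : 0 <= mu m.
Proof. by case: pmu. Qed.

Lemma is_prob_cvg : cvgn (series (mu \o Some)).
Proof.
case: pmu => mu0 mu1; apply/nnseries_cvgP; first by move=> k; exact: mu0.
by rewrite (@le_lt_trans _ _ 1%E) ?ltry// -mu1 leeDr// lee_fin.
Qed.

Lemma is_prob_mass : mass mu = 1.
Proof.
by case: pmu => _; rewrite -EFin_limn_series; [case|exact: is_prob_cvg].
Qed.

Lemma is_prob_gf1 : gf (mu \o Some) 1 = 1 - mu None.
Proof. by rewrite gf1 -is_prob_mass /mass addrAC subrr add0r. Qed.

Let gf_bounds x : 0 <= x <= 1 ->
  mu (Some 0%N) + mu (Some 1%N) * x <= gf (mu \o Some) x /\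
  gf (mu \o Some) x <= mu (Some 0%N) + mu (Some 1%N) * x +
    (1 - mu (Some 0%N) - mu (Some 1%N)) * x ^+ 2.
Proof.
move=> x01; have mu0 k : 0 <= (mu \o Some) k by exact: is_prob_ge0.
split; first exact: (gf_ge_affine mu0 is_prob_cvg).
apply: le_trans (gf_le_quadratic mu0 is_prob_cvg x01) _.
rewrite lerD2l ler_wpM2r ?exprn_ge0//; first by case/andP: x01.
by rewrite is_prob_gf1 !lerD2r gerBl is_prob_ge0.
Qed.

Lemma gf_displacement_le x : 0 <= x <= 1 ->
  `|gf (mu \o Some) x - x| <= 1 - mu (Some 1%N).
Proof.
move=> /[dup] x01 /andP[x0 x1]; have [lo up] := gf_bounds x01.
have p0 := is_prob_ge0 (Some 0%N).
have [|lo1 up1] := @gf_bounds 1; first by rewrite ler01 lexx.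
have x2 : x ^+ 2 <= 1 by rewrite exprn_ile1.
by rewrite ler_norml; apply/andP; split; nra.
Qed.

(* Unless p_0 is large, a generating function with small p_1 lies far below the
   diagonal at 1/2. *)
Lemma onem_prob1_le : 1 - mu (Some 1%N) <=
  3 * gf (mu \o Some) 0 + 4 * `|gf (mu \o Some) 2^-1 - 2^-1|.
Proof.
have [|lo0 _] := @gf_bounds 0; first by rewrite ler01 lexx.
have [|_ up2] := @gf_bounds 2^-1.
  by rewrite invr_ge0 ler0n invf_le1 ?ler1n.
rewrite distrC; set e := (X in `|X|); have := ler_norm e; rewrite /e => ne.
by move: up2 lo0 ne; rewrite expr2; lra.
Qed.

End probability_N0s.

Lemma N0s_mean_conv mu nu : is_prob mu -> is_prob nu ->
  N0s_mean (Defs.conv mu nu) = (N0s_mean mu + N0s_mean nu)%E.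
Proof.
move=> pmu pnu; have mu0 := is_prob_ge0 pmu; have nu0 := is_prob_ge0 pnu.
have mass_fin_ge0 : 0 <= mass_fin mu.
  apply: limr_ge; first exact: is_prob_cvg.
  by apply: nearW => n; apply: sumr_ge0 => k _; exact: mu0.
have convN : Defs.conv mu nu None = mu None + mass_fin mu * nu None.
  by rewrite /= (is_prob_mass pnu) mulr1.
have conv0 m : 0 <= Defs.conv mu nu m.
  case: m => [k|]; first by apply: sumr_ge0 => i _; rewrite mulr_ge0.
  by rewrite convN addr_ge0// mulr_ge0.
have := mu0 None; rewrite le_eqVlt => /predU1P[muN|muN]; last first.
  rewrite (N0s_mean_None_gt0 mu0)// N0s_mean_None_gt0//; last first.
    by rewrite convN ltr_wpDr// mulr_ge0.
  by rewrite addye// gt_eqF// (lt_le_trans _ (N0s_mean_ge0 nu0)).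
have mass_fin1 : mass_fin mu = 1.
  by rewrite -(is_prob_mass pmu) /mass -muN add0r.
have := nu0 None; rewrite le_eqVlt => /predU1P[nuN|nuN]; last first.
  rewrite (N0s_mean_None_gt0 nu0)// N0s_mean_None_gt0//.
    by rewrite addey// gt_eqF// (lt_le_trans _ (N0s_mean_ge0 mu0)).
  by rewrite convN -muN mass_fin1 mul1r add0r.
rewrite !N0s_mean_None0// ?convN -?muN -?nuN ?mulr0 ?addr0//.
have [[_ mu1] [_ nu1]] := (pmu, pnu); rewrite -muN -nuN !add0e in mu1 nu1.
apply: (@first_moment_convolution _ (mu \o Some) (nu \o Some)) => // k.
  exact: mu0.
exact: nu0.
Qed.

End measure_N0s.

Section boundary_values.
Context {R : realType}.
Implicit Types (mu : N0s -> R) (x : R).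

Lemma cmod_real x : cmod (x%:C)%C = `|x|.
Proof. by rewrite /cmod /= expr0n/= addr0 sqrtr_sqr. Qed.

Lemma pgf_real mu x : pgf mu (x%:C)%C = ((gf (mu \o Some) x)%:C)%C.
Proof.
rewrite /pgf /cseries; congr (_ +i* _)%C.
  by congr (limn (series _)); apply/funext => n; rewrite -rmorphXn.
rewrite [X in series X](_ : _ = fun=> 0); last first.
  by apply/funext => n; rewrite -rmorphXn/= mulr0.
rewrite (_ : series _ = fun=> 0) ?lim_cst//.
by apply/funext => n; rewrite /series/= big1.
Qed.

Lemma on_reals_pgf mu : on_reals (pgf mu) = gf (mu \o Some).
Proof. by apply/funext => x; rewrite /on_reals pgf_real. Qed.

Section probability.
Variable mu : N0s -> R.
Hypothesis pmu : is_prob mu.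

Lemma at1_pgf : at1 (on_reals (pgf mu)) = (1 - mu None)%:E.
Proof.
rewrite on_reals_pgf -(is_prob_gf1 pmu); apply/cvg_lim => //.
apply: cvg_EFin; first exact: nearW.
apply: summable_gf_cvg_left1; last exact: is_prob_cvg.
by move=> k; exact: is_prob_ge0.
Qed.

Lemma at1_derive_pgf :
  at1 (derive1 (on_reals (pgf mu))) = first_moment (mu \o Some).
Proof.
have mu0 k : 0 <= (mu \o Some) k by exact: is_prob_ge0.
have cmu := is_prob_cvg pmu; rewrite on_reals_pgf; apply/cvg_lim => //.
apply: eq_cvg_left1 (gf_diffs_cvg_left1 mu0 cmu) => x /andP[x0 x1].
have [|_ <-] := summable_is_derive_gf mu0 cmu (x := x); first by rewrite ltW.
by rewrite derive1E.
Qed.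

Lemma N0s_mean_ltyP : (N0s_mean mu < +oo)%E <->
  at1 (on_reals (pgf mu)) = 1%:E /\ (at1 (derive1 (on_reals (pgf mu))) < +oo)%E.
Proof.
have mu0 := is_prob_ge0 pmu; rewrite at1_pgf at1_derive_pgf; split.
  move=> /[dup] /(N0s_mean_lty_None mu0) muN.
  by rewrite (N0s_mean_None0 muN) muN subr0.
move=> [[] /eqP]; rewrite subr_eq addrC -subr_eq subrr eq_sym => /eqP muN.
by rewrite N0s_mean_None0.
Qed.

Lemma N0s_mean_at1 : (N0s_mean mu < +oo)%E ->
  N0s_mean mu = at1 (derive1 (on_reals (pgf mu))).
Proof.
move=> /(N0s_mean_lty_None (is_prob_ge0 pmu)) muN.
by rewrite at1_derive_pgf N0s_mean_None0.
Qed.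

End probability.

Definition herglotz_fun mu x : R :=
  mu None * x + limn (series (fun k => mu (Some k) * (x - x ^+ k))).

Section finite_measure.
Variable mu : N0s -> R.
Hypotheses (mu0 : forall m, 0 <= mu m) (cmu : cvgn (series (mu \o Some))).

Let p0 k : 0 <= (mu \o Some) k. Proof. exact: mu0. Qed.

Lemma herglotz_funE x : 0 <= x <= 1 ->
  herglotz_fun mu x = mass mu * x - gf (mu \o Some) x.
Proof.
move=> x01; rewrite /herglotz_fun /mass mulrDl -addrA; congr (_ + _).
apply/cvg_lim => //; rewrite (_ : series _ = fun n =>
  series (mu \o Some) n * x - pseries (mu \o Some) x n).
  apply: cvgB; first by apply: cvgM; [exact: cmu|exact: cvg_cst].
  exact: cvg_summable_pseries.
apply/funext => n; rewrite /pseries/series/= mulr_suml -sumrB.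
by apply: eq_bigr => k _; rewrite mulrBr.
Qed.

Lemma herglotz_fun_secant x : 0 <= x < 1 ->
  herglotz_fun mu x = (1 - x) * (fine (secant mu x) - mass mu).
Proof.
move=> /[dup] x01 /andP[x0 x1]; rewrite secantE// herglotz_funE ?x0 ?ltW//=.
by field; rewrite subr_eq0 gt_eqF.
Qed.

Lemma herglotz_fun_cvg_left1 : herglotz_fun mu x @[x --> 1^'-] --> mu None.
Proof.
apply: (eq_cvg_left1 (f := fun x => mass mu * x - gf (mu \o Some) x)).
  by move=> x /andP[x0 x1]; rewrite herglotz_funE// !ltW.
have -> : mu None = mass mu * 1 - gf (mu \o Some) 1.
  by rewrite mulr1 gf1 /mass addrK.
apply: cvgB; last exact: summable_gf_cvg_left1.
apply: cvgM; first exact: cvg_cst.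
by apply: cvg_at_left_filter; exact: cvg_id.
Qed.

Lemma is_derive_herglotz_fun x : 0 < x < 1 ->
  is_derive x 1 (herglotz_fun mu) (mass mu - gf (pseries_diffs (mu \o Some)) x).
Proof.
move=> /andP[x0 x1].
have dgf : is_derive x 1 (gf (mu \o Some)) (gf (pseries_diffs (mu \o Some)) x).
  by apply: summable_is_derive_gf => //; rewrite ltW.
have : is_derive x 1 (fun y => mass mu * y - gf (mu \o Some) y)
    (mass mu * 1 - gf (pseries_diffs (mu \o Some)) x) by exact: is_deriveB.
rewrite mulr1; apply: near_eq_is_derive; near=> y.
rewrite herglotz_funE//; apply/andP; split; near: y.
  by apply: filterS (lt_nbhsr x0) => y; exact: ltW.
by apply: filterS (lt_nbhsl x1) => y; exact: ltW.
Unshelve. all: by end_near. Qed.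

Lemma derive_herglotz_fun_cvg_left1 :
  (derive1 (herglotz_fun mu) x)%:E @[x --> 1^'-] -->
  ((mass mu)%:E - first_moment (mu \o Some))%E.
Proof.
apply: (eq_cvg_left1 (f :=
  (fun x => (mass mu)%:E - (gf (pseries_diffs (mu \o Some)) x)%:E)%E)).
  by move=> x /is_derive_herglotz_fun[_]; rewrite -EFinB derive1E => ->.
apply: cvgeB; [by rewrite fin_num_adde_defr|exact: cvg_cst|].
exact: gf_diffs_cvg_left1.
Qed.

End finite_measure.

Section nonnegative_measure.
Variable mu : N0s -> R.
Hypothesis mu0 : forall m, 0 <= mu m.

Lemma cvg_series_herglotz_fun x : 0 < x < 1 ->
  cvgn (series (fun k => mu (Some k) * (x - x ^+ k))) ->
  cvgn (series (mu \o Some)).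
Proof.
move=> /andP[x0 x1] cx; pose c := x * (1 - x).
have c0 : 0 < c by rewrite mulr_gt0// subr_gt0.
have c_le k : c <= x - x ^+ k.+2.
  rewrite /c mulrBr mulr1 lerB// -expr2.
  by rewrite ler_wiXn2l ?(ltW x0) ?(ltW x1).
have shift2 (u : nat -> R) :
    cvgn (series (fun k => u k.+2)) <-> cvgn (series u).
  by rewrite (cvg_series_shiftS (fun k => u k.+1)); exact: cvg_series_shiftS.
move/(shift2 (fun k => mu (Some k) * (x - x ^+ k))) in cx.
apply/(shift2 (mu \o Some)).
apply: (@series_le_cvg _ _
  (fun k => c^-1 * (mu (Some k.+2) * (x - x ^+ k.+2)))) => [k|k|k|].
- exact: mu0.
- rewrite mulr_ge0 ?invr_ge0 ?(ltW c0)// mulr_ge0//.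
  by rewrite (le_trans _ (c_le k))// ltW.
- by rewrite /= ler_pdivlMl// mulrC ler_wpM2l.
- exact: is_cvg_seriesZ.
Qed.

(* A divergent series takes the junk value 0. *)
Lemma derive_herglotz_fun_dvg x : ~ cvgn (series (mu \o Some)) -> 0 < x < 1 ->
  derive1 (herglotz_fun mu) x = mu None.
Proof.
move=> dmu /andP[x0 x1]; rewrite derive1E.
have dlin : is_derive x 1 (fun y => mu None * y) (mu None * 1).
  exact: is_deriveZ.
suff : is_derive x 1 (herglotz_fun mu) (mu None * 1).
  by case=> _ ->; rewrite mulr1.
apply: near_eq_is_derive dlin; near=> y.
rewrite /herglotz_fun [limn _]dvgP ?addr0//; apply: contra_not dmu.
apply: cvg_series_herglotz_fun; apply/andP.
by split; near: y; [exact: lt_nbhsr|exact: lt_nbhsl].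
Unshelve. all: by end_near. Qed.

Lemma at1_derive_herglotz_fun : at1 (derive1 (herglotz_fun mu)) =
  if (\sum_(k <oo) (mu (Some k))%:E < +oo)%E
  then ((mass mu)%:E - first_moment (mu \o Some))%E
  else (mu None)%:E.
Proof.
have p0 k : 0 <= (mu \o Some) k by exact: mu0.
apply/cvg_lim => //; case: ifPn => [lty|/negP lty].
  by apply: derive_herglotz_fun_cvg_left1 => //; apply/(nnseries_cvgP p0).
apply: (eq_cvg_left1 (f := fun=> (mu None)%:E)); last exact: cvg_cst.
move=> x x01; rewrite derive_herglotz_fun_dvg//; apply: contra_not lty.
by move/(nnseries_cvgP p0).
Qed.

End nonnegative_measure.
End boundary_values.

(** * Transition probabilities and expectations *)

Section process_expectation.
Context {R : realType} (d : measure_display) (Omega : measurableType d).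
Variables (P : R -> N0s -> probability Omega R) (N : R -> Omega -> N0s).
Variable ell : R -> R -> N0s -> N0s -> R.
Hypothesis bp : branching_process P N ell.

Lemma measurable_preimage_N0s t (B : set N0s) : 0 <= t ->
  measurable (N t @^-1` B).
Proof.
move=> t0; case: bp => _ mN _ _; rewrite (_ : _ @^-1` _ =
    \bigcup_(k : N0s) (if k \in B then N t @^-1` [set k] else set0)).
  apply: countable_bigcupT_measurable; first exact: countableP.
  by move=> k; case: ifP => _; [exact: mN|exact: measurable0].
apply/seteqP; split => w /=.
  by move=> Bw; exists (N t w) => //=; rewrite mem_set.
by move=> [k _]; case: ifPn => // /set_mem Bk /= ->.
Qed.

Lemma measurable_fun_N0s t d' (U : measurableType d') (f : N0s -> U) : 0 <= t ->
  measurable_fun setT (f \o N t).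
Proof.
move=> t0 _ B mB; rewrite setTI.
exact: (@measurable_preimage_N0s t (f @^-1` B)).
Qed.

Lemma transition_probability s u n k : 0 <= s <= u ->
  P s n (N u @^-1` [set k]) = (ell s u n k)%:E.
Proof.
move=> /andP[s0 su]; have u0 := le_trans s0 su.
case: (bp) => _ mN Ps markov.
have bounded_indic : exists M : R, forall x : N0s, `|(x == k)%:R| <= M.
  by exists 1 => x; case: (x == k); rewrite ?normr1 ?normr0.
have filtrT : nat_filtration N s s [set: Omega].
  by rewrite -[setT]setD0; apply: sigma_algebraCD; exact: sigma_algebra0.
have := @markov s s u n setT (fun m => (m == k)%:R).
rewrite s0 lexx => /(_ isT su bounded_indic filtrT) markovT.
transitivity (\int[P s n]_w ((N u w == k)%:R)%:E)%E.
  transitivity (\int[P s n]_w (\1_(N u @^-1` [set k]) w)%:E)%E.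
    by rewrite integral_indic ?setIT//; exact: mN.
  apply: eq_integral => w _; rewrite indicE; congr ((nat_of_bool _)%:R%:E).
  by apply/idP/idP => [/set_mem ->//|/eqP Nuk]; exact: mem_set.
rewrite {}markovT.
rewrite (@ae_eq_integral _ _ _ (P s n) setT (cst (ell s u n k)%:E)) //.
- rewrite integral_cst// [X in (_ * X)%E](@probability_setT _ _ _ (P s n)).
  by rewrite mule1.
- exact: (@measurable_fun_N0s s _ _
    (fun m => (kint (ell s u m) (fun m => (m == k)%:R))%:E)).
exists (~` (N s @^-1` [set n])); split.
- by apply: measurableC; exact: mN.
- by rewrite [LHS](@probability_setC _ _ _ (P s n)) ?Ps ?subee//; exact: mN.
- by move=> w /= neq Nw; apply: neq => _; rewrite Nw kint_indicator.
Qed.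

Lemma expectE s n u : 0 <= s <= u -> expect P N s n u = N0s_mean (ell s u n).
Proof.
move=> /[dup] su /andP[s0 s_le_u]; have u0 := le_trans s0 s_le_u.
case: (bp) => [[ell_prob _ _ _ _] mN _ _].
have ell0 k : (0 <= (ell s u n k)%:E)%E.
  by rewrite lee_fin (is_prob_ge0 (ell_prob s u n su)).
have ext0 m : (0 <= @extN0s R m)%E by case: m => [k|] //=; rewrite lee_fin.
pose state (j : nat) : N0s := if j is k.+1 then Some k else None.
pose F j := N u @^-1` [set state j].
have UF : setT = \bigcup_j F j.
  apply/seteqP; split => // w _; rewrite /F.
  by case E : (N u w) => [k|]; [exists k.+1|exists 0%N].
have state_inj : injective state by move=> [|i] [|j] //= [->].
rewrite /expect UF ge0_integral_bigcup//; last 3 first.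
- by move=> j; exact: mN.
- by rewrite -UF; exact: (measurable_fun_N0s (@extN0s R)).
- apply/trivIsetP => i j _ _ /eqP ij; rewrite -subset0 => w [].
  by rewrite /F /= => -> Nj; exact/ij/state_inj.
transitivity (\sum_(j <oo) (extN0s (state j) * (ell s u n (state j))%:E))%E.
  apply: eq_eseriesr => j _; rewrite -transition_probability//.
  rewrite -integral_cst; last exact: mN.
  by apply: eq_integral => w /set_mem /= ->.
rewrite nneseries_recl//=; last by move=> j _; rewrite mule_ge0.
rewrite muleC; congr (_ + _)%E.
rewrite -(nneseries_addn 1); last by move=> j; rewrite mule_ge0.
by apply: eq_eseriesr => k _; rewrite addn1.
Qed.

Lemma transition_mean s u n : 0 <= s <= u ->
  N0s_mean (ell s u (Some n)) = (n%:R%:E * N0s_mean (ell s u (Some 1%N)))%E.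
Proof.
move=> su; case: (bp) => [[ell_prob _ _ _ /(_ s u su)[ell_conv ell0 _]] _ _ _].
have mean0 m : (0 <= N0s_mean (ell s u m))%E.
  by apply: N0s_mean_ge0; exact: is_prob_ge0 (ell_prob s u m su).
elim: n => [|n IHn].
  rewrite mul0e N0s_mean_None0 ?ell0//.
  rewrite /first_moment eseries0// => -[|k] _ _; rewrite ?mul0r//=.
  by rewrite ell0 mulr0.
rewrite -[Some n.+1]/(addN0s (Some 1%N) (Some n)) (funext (ell_conv _ _)).
rewrite N0s_mean_conv ?IHn; [|exact: ell_prob..].
by rewrite -[n.+1]add1n natrD EFinD ge0_muleDl ?lee_fin// mul1e.
Qed.

Lemma expect_mean s n u : 0 <= s <= u ->
  expect P N s (Some n) u = (n%:R%:E * N0s_mean (ell s u (Some 1%N)))%E.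
Proof. by move=> su; rewrite expectE// transition_mean. Qed.

End process_expectation.

(** * Locally integrable functions on the half-line *)

Section locally_integrable_halfline.
Context {R : realType}.
Local Notation leb := (@lebesgue_measure R).
Implicit Types (f g : R -> \bar R) (Q : R -> Prop) (s t T r : R).

Lemma in_itv0_ge0 T r : `[0, T]%classic r -> 0 <= r.
Proof. by rewrite /= in_itv/= => /andP[]. Qed.

Lemma ae_halfline Q :
  (forall T, 0 <= T -> {ae leb, forall r, `[0, T]%classic r -> Q r}) ->
  {ae leb, forall r, 0 <= r -> Q r}.
Proof.
move=> Qitv.
have : {ae leb, forall r, forall n : nat, `[0, n%:R]%classic r -> Q r}.
  by apply/ae_foralln => n; exact: Qitv.
apply: filterS => r Qr r0; apply: (Qr (Num.bound r)).
by rewrite /= in_itv/= r0 ltW// archi_boundP.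
Qed.

Lemma L1loc_itv f s t : 0 <= s -> 0 <= t -> L1loc f ->
  leb.-integrable `[s, t] f.
Proof. by move=> s0 t0 /(_ t t0); exact: integrable_subitv. Qed.

Lemma L1loc_measurable f T : 0 <= T -> L1loc f -> measurable_fun `[0, T] f.
Proof. by move=> T0 /(_ T T0); exact: measurable_int. Qed.

Lemma L1loc_ae_fin_num f : L1loc f ->
  {ae leb, forall r, 0 <= r -> f r \is a fin_num}.
Proof.
by move=> fL; apply: ae_halfline => T T0; apply: integrable_ae => //; exact: fL.
Qed.

Lemma L1locD f g : L1loc f -> L1loc g -> L1loc (fun r => f r + g r)%E.
Proof.
by move=> fL gL T T0; apply: integrableD => //; [exact: fL|exact: gL].
Qed.

Lemma L1locB f g : L1loc f -> L1loc g -> L1loc (fun r => f r - g r)%E.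
Proof.
by move=> fL gL T T0; apply: integrableB => //; [exact: fL|exact: gL].
Qed.

Lemma eq_L1loc f g : (forall r, 0 <= r -> f r = g r) -> L1loc f -> L1loc g.
Proof.
move=> fg fL T T0; apply: eq_integrable (fL T T0) => // r.
by rewrite inE => /in_itv0_ge0/fg.
Qed.

Lemma L1loc_le f g : (forall T, 0 <= T -> measurable_fun `[0, T] f) ->
  (forall r, 0 <= r -> (0 <= f r <= g r)%E) -> L1loc g -> L1loc f.
Proof.
move=> mf fg gL T T0; apply: le_integrable (gL T T0) => //; first exact: mf.
move=> r /in_itv0_ge0/fg/andP[f0 f_le].
by rewrite !gee0_abs// (le_trans f0).
Qed.

Lemma L1loc_ae_eq f g : (forall T, 0 <= T -> measurable_fun `[0, T] f) ->
  {ae leb, forall r, 0 <= r -> f r = g r} -> L1loc g -> L1loc f.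
Proof.
move=> mf fg gL T T0; have igT := gL T T0.
apply/integrableP; split; first exact: mf.
have /integrableP[mg] := igT; apply: le_lt_trans.
rewrite le_eqVlt; apply/orP; left; apply/eqP/ae_eq_integral => //.
- by apply: measurableT_comp => //; exact: mf.
- exact: measurableT_comp.
- by apply: filterS fg => r fg /in_itv0_ge0 r0; rewrite fg.
Qed.

End locally_integrable_halfline.

(** * The rates of a generating family *)

Section rates.
Context {R : realType}.
Local Notation leb := (@lebesgue_measure R).
Variables (q : R -> R) (alpha : R -> nat -> R).
Hypothesis gen : generating_family q alpha.
Implicit Types (r T : R) (k : nat) (m : N0s).

Definition rates (r : R) : N0s -> R := fun m =>
  if m is Some k then if k == 1%N then 0 else alpha r k else q r.

Local Notation rate_sum r := (\sum_(k <oo) (rates r (Some k))%:E)%E.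
Local Notation rate_moment r := (first_moment (rates r \o Some)).

Lemma rates_ge0 r : 0 <= r -> forall m, 0 <= rates r m.
Proof.
case: gen => q0 alpha0 _ _ _ r0 [k|] /=; last exact: q0.
by case: ifP => // _; exact: alpha0.
Qed.

Lemma nneseries_rates r (w : nat -> R) : 0 <= r -> (forall k, 0 <= w k) ->
  (\sum_(k <oo | k != 1%N) (w k * alpha r k)%:E =
   \sum_(k <oo) (w k * rates r (Some k))%:E)%E.
Proof.
move=> r0 w0; rewrite eseries_mkcond; apply: eq_eseriesr => k _ /=.
by case: eqP => // _; rewrite mulr0.
Qed.

Lemma on_reals_herglotz r :
  on_reals (herglotz q alpha ^~ r) = herglotz_fun (rates r).
Proof.
apply/funext => x; rewrite /on_reals /herglotz /cseries /= !mul0r subr0.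
by congr (_ + limn (series _)); apply/funext => k; rewrite -rmorphXn.
Qed.

Lemma measurable_rates T m : 0 <= T ->
  measurable_fun `[0, T] (fun r => rates r m).
Proof.
move=> T0; case: gen => _ _ malpha qL _; case: m => [k|] /=; last first.
  by apply/measurable_EFinP; exact: L1loc_measurable qL.
case: eqP => _; first exact: measurable_cst.
apply: measurable_funS (malpha k); last by move=> r /in_itv0_ge0.
rewrite (_ : [set _ | _] = `[0, +oo[%classic); first exact: measurable_itv.
by apply/seteqP; split => r /=; rewrite in_itv/= andbT.
Qed.

Lemma measurable_weighted_rates T (w : nat -> R) :
  0 <= T -> (forall k, 0 <= w k) ->
  measurable_fun `[0, T] (fun r => \sum_(k <oo) (w k * rates r (Some k))%:E)%E.
Proof.
move=> T0 w0; apply: ge0_emeasurable_sum => [k r /in_itv0_ge0 r0 _|k _].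
  by rewrite lee_fin mulr_ge0// rates_ge0.
apply/measurable_EFinP; apply: measurable_funM; first exact: measurable_cst.
exact: measurable_rates.
Qed.

Lemma L1loc_rate_sum : L1loc (fun r => rate_sum r).
Proof.
case: gen => _ _ _ _; apply: eq_L1loc => r r0.
under eq_eseriesr do rewrite -[alpha r _]mul1r.
rewrite (@nneseries_rates _ (fun=> 1))//.
by under eq_eseriesr do rewrite mul1r.
Qed.

Lemma ae_rates_summable :
  {ae leb, forall r, 0 <= r -> cvgn (series (rates r \o Some))}.
Proof.
apply: filterS (L1loc_ae_fin_num L1loc_rate_sum) => r fin r0.
apply/nnseries_cvgP; first by move=> k; exact: rates_ge0.
by have := fin r0; rewrite fin_numElt => /andP[].
Qed.

Lemma L1loc_rates_mass : L1loc (fun r => (mass (rates r))%:E).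
Proof.
have massE r : 0 <= r -> mass (rates r) = q r + fine (rate_sum r).
  by move=> r0; rewrite /mass /mass_fin limn_nnseries// => k; exact: rates_ge0.
case: gen => _ _ _ qL _; apply: L1loc_ae_eq (L1locD qL L1loc_rate_sum).
  move=> T T0; apply/measurable_EFinP.
  apply: (@eq_measurable_fun _ _ _ _ _ (fun r => q r + fine (rate_sum r))).
    by move=> r; rewrite inE => /in_itv0_ge0/massE ->.
  apply: measurable_funD.
    by apply/measurable_EFinP; exact: L1loc_measurable qL.
  by apply: measurableT_comp => //; exact: L1loc_measurable L1loc_rate_sum.
apply: filterS (L1loc_ae_fin_num L1loc_rate_sum) => r fin r0.
by rewrite massE// EFinD fineK// fin.
Qed.

Lemma measurable_rates_mean T : 0 <= T ->
  measurable_fun `[0, T] (fun r => N0s_mean (rates r)).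
Proof.
move=> T0; apply: emeasurable_funD; last exact: measurable_weighted_rates.
apply: emeasurable_funM; last exact: measurable_cst.
by apply/measurable_EFinP; exact: (measurable_rates None).
Qed.

Lemma L1loc_rates_meanP : L1loc (fun r => N0s_mean (rates r)) <->
  {ae leb, forall r, 0 <= r -> q r = 0} /\ L1loc (fun r => rate_moment r).
Proof.
split=> [meanL|[q0 momentL]]; last first.
  apply: L1loc_ae_eq momentL; first exact: measurable_rates_mean.
  by apply: filterS q0 => r q0 r0; rewrite N0s_mean_None0//; exact: q0.
split; last first.
  apply: L1loc_le meanL; first by move=> T T0; exact: measurable_weighted_rates.
  move=> r r0; rewrite first_moment_ge0 ?leeDr//; last first.
    by move=> k; exact: rates_ge0.
  by rewrite mule_ge0// lee_fin; exact: (rates_ge0 r0 None).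
apply: filterS (L1loc_ae_fin_num meanL) => r fin r0.
apply: (N0s_mean_lty_None (rates_ge0 r0)).
by have := fin r0; rewrite fin_numElt => /andP[].
Qed.

Lemma weighted_rates_sumE r : 0 <= r ->
  (\sum_(n <oo | n != 1%N) (n.+1%:R * alpha r n)%:E =
   rate_moment r + rate_sum r)%E.
Proof.
move=> r0; rewrite (nneseries_rates r0 (w := fun n => n.+1%:R))//.
rewrite /first_moment -nneseriesD.
- by apply: eq_eseriesr => k _; rewrite -EFinD -natr1 mulrDl mul1r.
- by move=> k _ _; rewrite lee_fin mulr_ge0//; exact: (rates_ge0 r0 (Some k)).
- by move=> k _ _; rewrite lee_fin; exact: (rates_ge0 r0 (Some k)).
Qed.

Lemma L1loc_weighted_ratesP :
  {ae leb, forall t, 0 <= t -> q t = 0} /\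
  L1loc (fun t => \sum_(n <oo | n != 1%N) (n.+1%:R * alpha t n)%:E)%E <->
  L1loc (fun r => N0s_mean (rates r)).
Proof.
rewrite L1loc_rates_meanP; split=> -[q0 wL]; split=> //.
  apply: L1loc_le wL; first by move=> T T0; exact: measurable_weighted_rates.
  move=> r r0; rewrite weighted_rates_sumE// first_moment_ge0 => [/=|k].
    rewrite leeDl// nneseries_ge0// => k _ _.
    by rewrite lee_fin; exact: (rates_ge0 r0 (Some k)).
  exact: rates_ge0.
apply: eq_L1loc (L1locD wL L1loc_rate_sum) => r r0.
by rewrite weighted_rates_sumE.
Qed.

Local Notation dPhi1 r := (at1 (derive1 (on_reals (herglotz q alpha ^~ r)))).

Lemma measurable_at1_derive_herglotz T : 0 <= T ->
  measurable_fun `[0, T] (fun r => dPhi1 r).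
Proof.
move=> T0; apply: (@eq_measurable_fun _ _ _ _ _ (fun r =>
    if (rate_sum r < +oo)%E then ((mass (rates r))%:E - rate_moment r)%E
    else (q r)%:E)).
  move=> r; rewrite inE => /in_itv0_ge0 r0; rewrite on_reals_herglotz.
  by rewrite at1_derive_herglotz_fun//; exact: rates_ge0.
apply: measurable_fun_if => //.
- apply: measurable_fun_lte; last exact: measurable_cst.
  exact: L1loc_measurable L1loc_rate_sum.
- apply: (measurable_funS (measurable_itv `[0, T])); first exact: subIsetl.
  apply: emeasurable_funB; last exact: measurable_weighted_rates.
  exact: L1loc_measurable L1loc_rates_mass.
- apply: (measurable_funS (measurable_itv `[0, T])); first exact: subIsetl.
  by apply/measurable_EFinP; exact: (measurable_rates None).
Qed.

Lemma ae_at1_derive_herglotzE :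
  {ae leb, forall r, 0 <= r ->
    dPhi1 r = ((mass (rates r))%:E - rate_moment r)%E}.
Proof.
apply: filterS ae_rates_summable => r cr r0.
rewrite on_reals_herglotz at1_derive_herglotz_fun; last exact: rates_ge0.
by rewrite (nnseries_cvgP _).1//; [move=> k; exact: rates_ge0|exact: cr].
Qed.

Lemma ae_at1_herglotz_eq0 :
  {ae leb, forall t, 0 <= t ->
    at1 (on_reals (herglotz q alpha ^~ t)) = 0%:E} <->
  {ae leb, forall t, 0 <= t -> q t = 0}.
Proof.
have at1E : {ae leb, forall t, 0 <= t ->
    at1 (on_reals (herglotz q alpha ^~ t)) = (q t)%:E}.
  apply: filterS ae_rates_summable => t ct t0.
  rewrite on_reals_herglotz; apply/cvg_lim => //.
  apply: cvg_EFin; first exact: nearW.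
  exact: herglotz_fun_cvg_left1 (rates_ge0 t0) (ct t0).
split; apply: filterS2 at1E => t at1E q0 t0; last by rewrite at1E// q0.
by have := q0 t0; rewrite at1E// => -[].
Qed.

Lemma L1loc_at1_derive_herglotzP :
  {ae leb, forall t, 0 <= t -> at1 (on_reals (herglotz q alpha ^~ t)) = 0%:E} /\
  L1loc (fun t => dPhi1 t) <-> L1loc (fun r => N0s_mean (rates r)).
Proof.
rewrite ae_at1_herglotz_eq0 L1loc_rates_meanP; split=> -[q0 fL]; split=> //.
  apply: L1loc_ae_eq (L1locB L1loc_rates_mass fL).
    by move=> T T0; exact: measurable_weighted_rates.
  apply: filterS ae_at1_derive_herglotzE => r dPhiE r0; rewrite dPhiE//.
  case: (rate_moment r) => [x||] //=.
  by rewrite -!EFinB opprB addrC subrK.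
apply: L1loc_ae_eq (L1locB L1loc_rates_mass fL).
  exact: measurable_at1_derive_herglotz.
exact: ae_at1_derive_herglotzE.
Qed.

Lemma integral_at1_derive_herglotz s t : 0 <= s -> 0 <= t ->
  L1loc (fun r => N0s_mean (rates r)) ->
  (\int[leb]_(r in `[s, t]) dPhi1 r =
    \int[leb]_(r in `[s, t]) (mass (rates r))%:E -
    \int[leb]_(r in `[s, t]) N0s_mean (rates r))%E.
Proof.
move=> s0 t0 meanL; rewrite -integralB//; last 2 first.
- exact: L1loc_itv L1loc_rates_mass.
- exact: L1loc_itv meanL.
have sub0 : `[s, t] `<=` `[0, t] by apply: subset_itvr; rewrite bnd_simp.
apply: ae_eq_integral => //.
- exact: measurable_funS (measurable_at1_derive_herglotz t0).
- apply: measurable_funS sub0 _ => //.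
  apply: emeasurable_funB; last exact: measurable_rates_mean.
  exact: L1loc_measurable L1loc_rates_mass.
have [q0 _] := L1loc_rates_meanP.1 meanL.
apply: filterS2 ae_at1_derive_herglotzE q0 => r dPhiE q0 /sub0/in_itv0_ge0 r0.
by rewrite dPhiE// N0s_mean_None0//; exact: q0.
Qed.

End rates.

(** * The evolution family on the real axis *)

Lemma ln_lipschitz {R : realType} (d x y : R) : 0 < d -> d <= x -> d <= y ->
  `|ln x - ln y| <= d^-1 * `|x - y|.
Proof.
move=> d0.
have ln_le (a b : R) : d <= a -> d <= b -> ln a - ln b <= d^-1 * `|a - b|.
  move=> da db; have a0 := lt_le_trans d0 da; have b0 := lt_le_trans d0 db.
  rewrite -ln_div ?posrE// (_ : a / b = 1 + (a - b) / b); last first.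
    by field; exact: lt0r_neq0.
  apply: (@le_trans _ _ ((a - b) / b)).
    by rewrite le_ln1Dx// mulrBl divff ?lt0r_neq0// ltrBrDl subrr divr_gt0.
  rewrite mulrC; apply: (@le_trans _ _ (b^-1 * `|a - b|)).
    by rewrite ler_wpM2l ?invr_ge0 ?(ltW b0)// ler_norm.
  by rewrite ler_wpM2r// lef_pV2// posrE.
move=> dx dy; rewrite ler_norml ln_le// andbT lerNl opprB distrC; exact: ln_le.
Qed.

Section left_sequences.
Context {R : realType}.

Lemma cvg_seq_at_left (u : R^nat) (p : R) : (forall n, u n < p) ->
  u @ \oo --> p -> u @ \oo --> p^'-.
Proof.
move=> up /cvgrPdist_lt cu A [e /= e0 eA]; have := cu e e0.
by apply: filterS => n /= pn; apply: eA => //=; rewrite distrC.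
Qed.

Definition onem_harmonic (n : nat) : R := 1 - n.+1%:R^-1.

Lemma onem_harmonic_itv n : 0 <= onem_harmonic n < 1.
Proof. by rewrite subr_ge0 invf_le1// ler1n/= ltrBlDr ltrDl. Qed.

Lemma onem_harmonic_homo : {homo onem_harmonic : m n / (m <= n)%N >-> m <= n}.
Proof. by move=> m n mn; rewrite lerB// lef_pV2 ?posrE// ler_nat. Qed.

Lemma cvg_onem_harmonic : onem_harmonic @ \oo --> 1^'-.
Proof.
apply: cvg_seq_at_left; first by move=> n; have /andP[] := onem_harmonic_itv n.
rewrite -[X in _ --> X]subr0; apply: cvgB; [exact: cvg_cst|exact: cvg_harmonic].
Qed.

End left_sequences.

Section evolution_family.
Context {R : realType}.
Local Notation leb := (@lebesgue_measure R).
Variable ell : R -> R -> N0s -> N0s -> R.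
Variables (q : R -> R) (alpha : R -> nat -> R).
Hypothesis bk : branching_kernels ell.
Hypothesis fam : abs_cont_rev_evol_family (pgfs ell).
Hypothesis gen : generating_family q alpha.
Hypothesis avf : associated_vector_field (pgfs ell) (herglotz q alpha).
Implicit Types (r s t u v x y T : R).

Local Notation offspring s t := (ell s t (Some 1%N)).
Local Notation F s t := (gf (offspring s t \o Some)).
Local Notation nu r := (rates q alpha r).
Local Notation mean s t := (N0s_mean (offspring s t)).

Lemma is_prob_offspring s t : 0 <= s <= t -> is_prob (offspring s t).
Proof. by move=> st; case: bk => ell_prob _ _ _ _; exact: ell_prob. Qed.

Lemma offspring_ge0 s t : 0 <= s <= t ->
  forall k, 0 <= (offspring s t \o Some) k.
Proof. by move=> /is_prob_offspring/is_prob_ge0 ell0 k; exact: ell0. Qed.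

Lemma offspring_cvg s t : 0 <= s <= t -> cvgn (series (offspring s t \o Some)).
Proof. by move=> /is_prob_offspring/is_prob_cvg. Qed.

Lemma offspring_cvg_pseries s t x : 0 <= s <= t -> 0 <= x <= 1 ->
  cvgn (pseries (offspring s t \o Some) x).
Proof.
move=> st; apply: cvg_summable_pseries; first exact: offspring_ge0.
exact: offspring_cvg.
Qed.

Lemma pgfs_real s t x : pgfs ell s t (x%:C)%C = ((F s t x)%:C)%C.
Proof. exact: pgf_real. Qed.

Lemma inD_real x : 0 <= x < 1 -> inD (x%:C)%C.
Proof. by move=> /andP[x0 x1]; rewrite /inD cmod_real ger0_norm. Qed.

Lemma evolution_itv s t x : 0 <= s <= t -> 0 <= x < 1 -> 0 <= F s t x < 1.
Proof.
move=> st x01; have /andP[x0 x1] := x01.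
have F0 : 0 <= F s t x.
  apply: gf_ge0 => //; first exact: offspring_ge0.
  by apply: offspring_cvg_pseries => //; rewrite x0 ltW.
rewrite F0 /= -(ger0_norm F0) -cmod_real -pgfs_real.
by case: fam => FD _ _ _; apply: FD => //; exact: inD_real.
Qed.

Lemma evolution_id s x : 0 <= s -> 0 <= x < 1 -> F s s x = x.
Proof.
move=> s0 /inD_real xD; case: fam => _ Fid _ _.
by have := Fid s _ s0 xD; rewrite pgfs_real => -[].
Qed.

Lemma evolution_comp s t u x : 0 <= s <= t -> t <= u -> 0 <= x < 1 ->
  F s u x = F s t (F t u x).
Proof.
move=> st tu /inD_real xD; case: fam => _ _ Fcomp _.
by have := Fcomp s t u _ st tu xD; rewrite !pgfs_real => -[].
Qed.

Lemma evolution_homo s t x y : 0 <= s <= t -> 0 <= x -> x <= y -> y <= 1 ->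
  F s t x <= F s t y.
Proof.
move=> st x0 xy y1; apply: gf_homo; [exact: offspring_ge0|by rewrite x0|].
by apply: offspring_cvg_pseries => //; rewrite (le_trans x0).
Qed.

Lemma in_itv_subDelta s t r : 0 <= s -> `[s, t]%classic r ->
  [/\ 0 <= r, s <= r, r <= t & 0 <= r <= t].
Proof.
move=> s0; rewrite /= in_itv/= => /andP[sr rt].
by rewrite (le_trans s0 sr) sr rt.
Qed.

Lemma pointwise_displacement_le x : 0 <= x < 1 -> exists2 g : R -> R,
  L1loc (EFin \o g) &
  forall s u, 0 <= s -> s <= u ->
    `|F s u x - x| <= \int[leb]_(r in `[s, u]) g r.
Proof.
move=> x01; case: fam => _ _ _ /(_ _ (inD_real x01))[g [gL Fg]].
exists g => // s u s0 su.
have := @Fg s s u; rewrite s0 lexx => /(_ isT su).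
rewrite !pgfs_real -rmorphB/= cmod_real evolution_id// /Rintegral.
rewrite -[X in (_ <= X)%E]fineK ?lee_fin//.
by apply: integrable_fin_num => //; exact: (L1loc_itv s0 (le_trans s0 su) gL).
Qed.

Lemma onem_offspring1_le : exists2 g : R -> R, L1loc (EFin \o g) &
  forall s u, 0 <= s -> s <= u ->
    1 - offspring s u (Some 1%N) <= \int[leb]_(r in `[s, u]) g r.
Proof.
have [|g gL g_ge] := @pointwise_displacement_le 0; first by rewrite lexx ltr01.
have [|h hL h_ge] := @pointwise_displacement_le 2^-1.
  by rewrite invr_ge0 ler0n invf_lt1 ?ltr1n.
have scaleL c (f : R -> R) : L1loc (EFin \o f) ->
    L1loc (EFin \o (fun r => c * f r)).
  move=> fL T T0; have ifT := fL T T0.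
  by apply: eq_integrable (integrableZl _ c ifT).
exists (fun r => 3 * g r + 4 * h r) => [|s u s0 su].
  exact: L1locD (scaleL 3 _ gL) (scaleL 4 _ hL).
have su0 : 0 <= s <= u by rewrite s0.
have integrable_su (f : R -> R) : L1loc (EFin \o f) ->
    leb.-integrable `[s, u] (EFin \o f).
  exact: L1loc_itv s0 (le_trans s0 su).
rewrite RintegralD//; [|exact/integrable_su/scaleL..].
rewrite !RintegralZl//; [|exact: integrable_su..].
rewrite (le_trans (onem_prob1_le (is_prob_offspring su0)))//.
apply: lerD; rewrite ler_wpM2l//; last exact: h_ge.
by rewrite (le_trans _ (g_ge _ _ s0 su))// subr0 ler_norm.
Qed.

(* F_{u,t}(x) is the image under F_{u,v} of F_{v,t}(x), and a generating
   function moves every point of [0, 1) by at most 1 - p_1. *)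
Lemma evolution_dominated : exists2 g : R -> R, L1loc (EFin \o g) &
  forall s t x, 0 <= s -> 0 <= x < 1 -> dominated_by g s t (fun r => F r t x).
Proof.
have [g gL g_ge] := onem_offspring1_le.
exists g => // s t x s0 x01 u v su uv vt.
have u0 := le_trans s0 su; have uv0 : 0 <= u <= v by rewrite u0.
rewrite (evolution_comp uv0 vt x01) distrC (le_trans _ (g_ge _ _ u0 uv))//.
apply: (gf_displacement_le (is_prob_offspring uv0)).
have /andP[y0 y1] : 0 <= F v t x < 1.
  by apply: evolution_itv => //; rewrite (le_trans u0 uv).
by rewrite y0 ltW.
Qed.

Lemma evolution_within_continuous s t x : 0 <= s <= t -> 0 <= x < 1 ->
  {within `[s, t], continuous (fun r => F r t x)}.
Proof.
move=> /andP[s0 st] x01; have [g gL Fg] := evolution_dominated.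
apply: (dominated_by_within_continuous st _ (Fg s t x s0 x01)).
exact: L1loc_itv s0 (le_trans s0 st) gL.
Qed.

Lemma onem_evolution_lbound s t x : 0 <= s <= t -> 0 <= x < 1 ->
  exists2 d, 0 < d & forall r, s <= r <= t -> d <= 1 - F r t x.
Proof.
move=> /[dup] st /andP[s0 st'] x01.
have [c] := EVT_max st' (evolution_within_continuous st x01).
rewrite in_itv/= => /andP[sc ct] cmax; exists (1 - F c t x).
  rewrite subr_gt0.
  have /andP[] // : 0 <= F c t x < 1.
  by apply: evolution_itv => //; rewrite (le_trans s0 sc).
by move=> r rst; rewrite lerB// cmax.
Qed.

Lemma measurable_secant_rates s t x : 0 <= s <= t -> 0 <= x < 1 ->
  measurable_fun `[s, t] (fun r => secant (nu r) (F r t x)).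
Proof.
move=> /[dup] st /andP[s0 s_le_t] x01; have t0 := le_trans s0 s_le_t.
have mF : measurable_fun `[s, t] (fun r => F r t x).
  apply: subspace_continuous_measurable_fun => //.
  exact: evolution_within_continuous.
have F01 r : `[s, t]%classic r -> 0 <= F r t x < 1.
  by case/(in_itv_subDelta s0) => *; exact: evolution_itv.
have mnu m : measurable_fun `[s, t] (fun r => nu r m).
  apply: measurable_funS (measurable_rates gen m t0) => //.
  by apply: subset_itvr; rewrite bnd_simp.
apply: emeasurable_funD.
  apply/measurable_EFinP; apply: measurable_funM; first exact: (mnu None).
  apply: subspace_continuous_measurable_fun => //.
  rewrite continuous_subspace_in => r; rewrite inE => rst.
  apply: cvgV; first by have /andP[_ F1] := F01 r rst; rewrite subr_eq0 gt_eqF.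
  by apply: cvgB; [exact: cvg_cst|exact: (evolution_within_continuous st x01)].
apply: ge0_emeasurable_sum => [k r rst _|k _].
  have /andP[F0 _] := F01 r rst; have [r0 _ _ _] := in_itv_subDelta s0 rst.
  by rewrite lee_fin mulr_ge0 ?geosum_ge0//; exact: (rates_ge0 gen r0 (Some k)).
apply/measurable_EFinP; apply: measurable_funM; first exact: (mnu (Some k)).
apply: (@measurableT_comp _ _ _ _ _ _ (geosum k)) => //.
by apply: continuous_measurable_fun; exact: continuous_geosum.
Qed.

Lemma is_derive_ln_onem_evolution s t x : 0 <= s <= t -> 0 <= x < 1 ->
  {ae leb, forall r, r \in `]s, t[ ->
    is_derive r 1 (fun r => ln (1 - F r t x))
      (mass (nu r) - fine (secant (nu r) (F r t x)))}.
Proof.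
move=> /andP[s0 st] x01; have t0 := le_trans s0 st.
apply: filterS2 (ae_rates_summable gen) (avf t0 (inD_real x01)) => r cr Fr.
rewrite in_itv/= => /andP[/ltW sr /ltW rt].
have r0 := le_trans s0 sr; have rt0 : 0 <= r <= t by rewrite r0.
have [] := Fr; first by rewrite in_itv/= rt0.
have -> : (fun u => complex.Re (pgfs ell u t (x%:C)%C)) = (fun u => F u t x).
  by apply/funext => u; rewrite pgfs_real.
move=> dF _ + _; rewrite pgfs_real derive1E.
have y01 := evolution_itv rt0 x01; have /andP[_ y1] := y01.
rewrite -[complex.Re _]/(on_reals (herglotz q alpha ^~ r) (F r t x)).
rewrite on_reals_herglotz herglotz_fun_secant//; [|exact: rates_ge0|exact: cr].
move=> /(DeriveDef dF) dF'.
have d1F : is_derive r 1 (fun u => 1 - F u t x)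
    (0 - (1 - F r t x) * (fine (secant (nu r) (F r t x)) - mass (nu r))).
  exact: is_deriveB.
have dln : is_derive (1 - F r t x) 1 (@ln R) (1 - F r t x)^-1.
  by apply: is_derive1_ln; rewrite subr_gt0.
have dcomp := @is_derive1_comp _ (@ln R) (fun u => 1 - F u t x) r _ _ dln d1F.
apply: (is_derive_eq dcomp); move: (fine _) => j.
by field; rewrite subr_eq0 gt_eqF.
Qed.

Lemma dominated_by_ln_onem_evolution s t x : 0 <= s <= t -> 0 <= x < 1 ->
  exists2 g : R -> R, leb.-integrable `[s, t] (EFin \o g) &
    dominated_by g s t (fun r => ln (1 - F r t x)).
Proof.
move=> /[dup] st /andP[s0 s_le_t] x01.
have [d d0 d_le] := onem_evolution_lbound st x01.
have [g gL Fg] := evolution_dominated.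
have ig := L1loc_itv s0 (le_trans s0 s_le_t) gL.
exists (fun r => d^-1 * g r).
  by apply: eq_integrable (integrableZl _ d^-1 ig).
move=> u v su uv vt; rewrite RintegralZl//; last exact: integrable_subitv ig.
rewrite (le_trans (ln_lipschitz d0 (d_le _ _) (d_le _ _)))//.
- by rewrite (le_trans su).
- by rewrite su (le_trans uv).
rewrite ler_wpM2l ?invr_ge0 ?(ltW d0)// opprB addrC subrKA distrC.
exact: (Fg s t x s0 x01).
Qed.

Theorem integral_secant_rates s t x : 0 <= s <= t -> 0 <= x < 1 ->
  (\int[leb]_(r in `[s, t]) secant (nu r) (F r t x) =
   (ln ((1 - F s t x) / (1 - x)) + \int[leb]_(r in `[s, t]) mass (nu r))%:E)%E.
Proof.
move=> /[dup] st /andP[s0 s_le_t] /[dup] x01 /andP[_ x1].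
have t0 := le_trans s0 s_le_t.
rewrite ln_div ?posrE ?subr_gt0//; last by have /andP[] := evolution_itv st x01.
move: s_le_t; rewrite le_eqVlt => /predU1P[<-|s_lt_t].
  by rewrite set_itv1 integral_set1 Rintegral_set1 evolution_id// subrr addr0.
have mS := measurable_secant_rates st x01.
have imass := L1loc_itv s0 t0 (L1loc_rates_mass gen).
have [g ig ln_g] := dominated_by_ln_onem_evolution st x01.
have dln := is_derive_ln_onem_evolution st x01.
have [|ih] := dominated_by_ftc s_lt_t ig ln_g _ dln.
  apply: measurable_funB; last exact: measurableT_comp mS.
  by apply/measurable_EFinP; exact: measurable_int imass.
rewrite evolution_id// => int_ln.
have iS : leb.-integrable `[s, t]
    (EFin \o (fun r => fine (secant (nu r) (F r t x)))).
  apply: (eq_integrable _ _ _ _ (integrableB _ imass ih)) => //= r _.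
  by rewrite -EFinB opprB addrC subrK.
have int_S : \int[leb]_(r in `[s, t]) fine (secant (nu r) (F r t x)) =
    ln (1 - F s t x) - ln (1 - x) + \int[leb]_(r in `[s, t]) mass (nu r).
  by move: int_ln; rewrite RintegralB//; lra.
rewrite -int_S /Rintegral fineK; last exact: integrable_fin_num.
apply: ae_eq_integral => //.
  by apply/measurable_EFinP; exact: measurableT_comp mS.
apply: filterS (ae_rates_summable gen) => r cr.
case/(in_itv_subDelta s0) => r0 _ _ rt.
by rewrite secantE//; [exact: rates_ge0|exact: cr|exact: evolution_itv].
Qed.

(** * Means *)

Lemma evolution_cvg_left1 s t : 0 <= s <= t ->
  F s t x @[x --> 1^'-] --> F s t 1.
Proof.
move=> st; apply: summable_gf_cvg_left1; first exact: offspring_ge0.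
exact: offspring_cvg.
Qed.

(* If F_{r,t}(1) = c < 1, then F_{s,t} <= F_{s,r}(c) < 1. *)
Lemma no_explosion r s t : 0 <= s <= r -> r <= t ->
  offspring s t None = 0 -> offspring r t None = 0.
Proof.
move=> /[dup] sr /andP[s0 s_le_r] rt st_None.
have r0 := le_trans s0 s_le_r; have rt0 : 0 <= r <= t by rewrite r0.
have st : 0 <= s <= t by rewrite s0 (le_trans s_le_r).
have [prt pst] := (is_prob_offspring rt0, is_prob_offspring st).
have := is_prob_ge0 prt None; rewrite le_eqVlt => /predU1P[<-//|rt_None].
have F1_lt1 : F r t 1 < 1 by rewrite (is_prob_gf1 prt) ltrBlDr ltrDl.
have F1_itv : 0 <= F r t 1 < 1.
  rewrite F1_lt1 andbT; apply: gf_ge0 => //; first exact: offspring_ge0.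
  by rewrite pseries1; exact: offspring_cvg.
have /andP[_] := evolution_itv sr F1_itv; rewrite ltNge => /negP[].
rewrite -[leLHS](subr0 (1 : R)) -st_None -(is_prob_gf1 pst).
apply: cvgr_to_le (evolution_cvg_left1 st) _.
apply: filterS near_left1 => x /andP[x0 x1].
have x01 : 0 <= x < 1 by rewrite ltW.
rewrite (evolution_comp sr rt x01).
have /andP[y0 _] := evolution_itv rt0 x01.
have F_le : F r t x <= F r t 1 by rewrite evolution_homo// ltW.
exact: (evolution_homo sr y0 F_le (ltW F1_lt1)).
Qed.

Lemma evolution_onem_harmonic_cvg r t : 0 <= r <= t -> offspring r t None = 0 ->
  F r t (onem_harmonic n) @[n --> \oo] --> 1^'-.
Proof.
move=> rt rt_None; apply: cvg_seq_at_left.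
  by move=> n; have /andP[] := evolution_itv rt (onem_harmonic_itv n).
have := evolution_cvg_left1 rt.
rewrite (is_prob_gf1 (is_prob_offspring rt)) rt_None subr0.
exact: cvg_comp cvg_onem_harmonic.
Qed.

Lemma secant_offspringE s t x : 0 <= s <= t -> 0 <= x < 1 ->
  secant (offspring s t) x = ((1 - F s t x) / (1 - x))%:E.
Proof.
move=> /(is_prob_offspring) pst x01; rewrite secantE ?(is_prob_mass pst)//.
  exact: is_prob_ge0.
exact: is_prob_cvg.
Qed.

Lemma secant_offspring_gt0 s t x : 0 <= s <= t -> 0 <= x < 1 ->
  0 < (1 - F s t x) / (1 - x).
Proof.
move=> st /[dup] x01 /andP[_ x1]; rewrite divr_gt0 ?subr_gt0//.
by have /andP[] := evolution_itv st x01.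
Qed.

Lemma secant_offspring_cvg_mean s t : 0 <= s <= t ->
  ((1 - F s t (onem_harmonic n)) / (1 - onem_harmonic n))%:E @[n --> \oo] -->
  mean s t.
Proof.
move=> st; have := cvg_comp _ _ cvg_onem_harmonic
  (secant_cvg_left1 (is_prob_ge0 (is_prob_offspring st))).
apply: cvg_trans; apply: near_eq_cvg; apply: nearW => n /=.
by rewrite secant_offspringE// onem_harmonic_itv.
Qed.

Lemma mean_fin_num s t : 0 <= s <= t -> (mean s t < +oo)%E ->
  mean s t \is a fin_num.
Proof.
move=> /(is_prob_offspring)/is_prob_ge0 ell0.
by rewrite ge0_fin_numE ?N0s_mean_ge0.
Qed.

Lemma fine_mean_gt0 s t : 0 <= s <= t -> (mean s t < +oo)%E ->
  0 < fine (mean s t).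
Proof.
move=> st mean_lty; have x01 := @onem_harmonic_itv R 0.
rewrite -lte_fin fineK ?mean_fin_num//.
apply: lt_le_trans (secant_le_mean (is_prob_ge0 (is_prob_offspring st)) x01).
by rewrite secant_offspringE// lte_fin secant_offspring_gt0.
Qed.

Lemma cvg_integral_secant_rates s t : 0 <= s <= t ->
  (forall r, s <= r <= t -> offspring r t None = 0) ->
  (\int[leb]_(r in `[s, t]) secant (nu r) (F r t (onem_harmonic n)))%E
    @[n --> \oo] --> (\int[leb]_(r in `[s, t]) N0s_mean (nu r))%E.
Proof.
move=> /[dup] st /andP[s0 _] no_expl.
have <- : (\int[leb]_(r in `[s, t])
      limn (fun n => secant (nu r) (F r t (onem_harmonic n))) =
    \int[leb]_(r in `[s, t]) N0s_mean (nu r))%E.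
  apply: eq_integral => r /set_mem/(in_itv_subDelta s0)[r0 sr r_le_t rt].
  apply/cvg_lim => //; have rt_None : offspring r t None = 0.
    by apply: no_expl; rewrite sr.
  apply: (cvg_comp _ _ (evolution_onem_harmonic_cvg rt rt_None)).
  exact: secant_cvg_left1 (rates_ge0 gen r0).
apply: (@cvg_monotone_convergence _ _ _ leb `[s, t] _
  (fun n r => secant (nu r) (F r t (onem_harmonic n)))) => //.
- by move=> n; apply: measurable_secant_rates => //; exact: onem_harmonic_itv.
- move=> n r /(in_itv_subDelta s0)[r0 _ _ rt].
  apply: (secant_ge0 (rates_ge0 gen r0)).
  exact: evolution_itv rt (onem_harmonic_itv n).
- move=> r /(in_itv_subDelta s0)[r0 _ _ rt] m n mn.
  have /andP[x0 _] := @onem_harmonic_itv R m.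
  have /andP[_ y1] := @onem_harmonic_itv R n.
  have /andP[Fx0 _] := evolution_itv rt (onem_harmonic_itv m).
  have /andP[_ Fy1] := evolution_itv rt (onem_harmonic_itv n).
  apply: (secant_homo (rates_ge0 gen r0)) => //.
  by rewrite evolution_homo ?onem_harmonic_homo// ltW.
Qed.

Theorem integral_mean_rates s t : 0 <= s <= t -> (mean s t < +oo)%E ->
  (\int[leb]_(r in `[s, t]) N0s_mean (nu r) =
   (ln (fine (mean s t)) + \int[leb]_(r in `[s, t]) mass (nu r))%:E)%E.
Proof.
move=> /[dup] st /andP[s0 _] mean_lty.
have pst := is_prob_offspring st.
have no_expl r : s <= r <= t -> offspring r t None = 0.
  move=> /andP[sr rt]; apply: (no_explosion _ rt (s := s)); first by rewrite s0.
  exact: N0s_mean_lty_None (is_prob_ge0 pst) mean_lty.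
have /fine_cvgP[_ secant_cvg] : ((1 - F s t (onem_harmonic n)) /
    (1 - onem_harmonic n))%:E @[n --> \oo] --> (fine (mean s t))%:E.
  by rewrite fineK ?mean_fin_num//; exact: secant_offspring_cvg_mean.
have := cvg_integral_secant_rates st no_expl.
under eq_fun do rewrite (integral_secant_rates st (onem_harmonic_itv _)).
move=> int_cvg; apply: cvg_unique int_cvg _ => //.
apply: cvg_EFin; first exact: nearW; apply: cvgD; last exact: cvg_cst.
apply: (cvg_comp _ _ secant_cvg); apply: continuous_ln.
exact: fine_mean_gt0.
Qed.

Lemma mean_lty s t : 0 <= s <= t -> L1loc (fun r => N0s_mean (nu r)) ->
  (mean s t < +oo)%E.
Proof.
move=> /[dup] st /andP[s0 s_le_t] meanL; have t0 := le_trans s0 s_le_t.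
have imean := L1loc_itv s0 t0 meanL.
pose M := fine (\int[leb]_(r in `[s, t]) N0s_mean (nu r))%E.
pose B := \int[leb]_(r in `[s, t]) mass (nu r).
apply: (@le_lt_trans _ _ (expR (M - B))%:E); last by rewrite ltry.
apply: cvge_to_le (secant_offspring_cvg_mean st) _; apply: nearW => n.
have x01 := @onem_harmonic_itv R n.
rewrite lee_fin -ler_ln ?posrE ?expR_gt0 ?secant_offspring_gt0// expRK lerBrDr.
rewrite -lee_fin -(integral_secant_rates st x01).
rewrite /M fineK; last exact: integrable_fin_num.
apply: ge0_le_integral => //.
- move=> r /(in_itv_subDelta s0)[r0 _ _ rt].
  exact: (secant_ge0 (rates_ge0 gen r0) (evolution_itv rt x01)).
- exact: measurable_secant_rates.
- exact: measurable_int imean.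
- move=> r /(in_itv_subDelta s0)[r0 _ _ rt].
  exact: (secant_le_mean (rates_ge0 gen r0) (evolution_itv rt x01)).
Qed.

Lemma mean_ltyP :
  (forall t, 0 <= t -> (mean 0 t < +oo)%E) <-> L1loc (fun r => N0s_mean (nu r)).
Proof.
split=> [mean_lty0 T T0|meanL t t0]; last by apply: mean_lty; rewrite ?lexx.
have T00 : (0 : R) <= 0 <= T by rewrite lexx.
apply/integrableP; split; first exact: measurable_rates_mean.
rewrite (_ : integral _ _ _ = \int[leb]_(r in `[0%R, T]) N0s_mean (nu r))%E.
  by rewrite integral_mean_rates ?ltry ?mean_lty0.
apply: eq_integral => r /set_mem/in_itv0_ge0 r0.
by rewrite gee0_abs// N0s_mean_ge0//; exact: rates_ge0.
Qed.

Lemma mean_expR s t : 0 <= s <= t -> L1loc (fun r => N0s_mean (nu r)) ->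
  mean s t = (expR (- fine (\int[leb]_(r in `[s, t])
    at1 (derive1 (on_reals (herglotz q alpha ^~ r))))%E))%:E.
Proof.
move=> /[dup] st /andP[s0 s_le_t] meanL; have t0 := le_trans s0 s_le_t.
have mean_st := mean_lty st meanL.
rewrite (integral_at1_derive_herglotz gen s0 t0 meanL) integral_mean_rates//.
rewrite -[X in (X - _)%E]fineK; last first.
  apply: integrable_fin_num => //.
  exact: L1loc_itv s0 t0 (L1loc_rates_mass gen).
rewrite -EFinB /=.
rewrite -[fine (integral _ _ _)]/(\int[leb]_(r in `[s, t]) mass (nu r)).
by rewrite opprB addrK lnK ?posrE ?fine_mean_gt0// fineK// mean_fin_num.
Qed.

End evolution_family.

Section finite_means.
Context {R : realType} (d : measure_display) (Omega : measurableType d).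
Variables (P : R -> N0s -> probability Omega R) (N : R -> Omega -> N0s).
Variable ell : R -> R -> N0s -> N0s -> R.
Variables (q : R -> R) (alpha : R -> nat -> R).
Hypothesis bp : branching_process P N ell.
Hypothesis fam : abs_cont_rev_evol_family (pgfs ell).
Hypothesis gen : generating_family q alpha.
Hypothesis avf : associated_vector_field (pgfs ell) (herglotz q alpha).
Implicit Types (n : nat) (s t : R).

Let bk : branching_kernels ell. Proof. by case: bp. Qed.

Local Notation L1loc_mean := (L1loc (fun r => N0s_mean (rates q alpha r))).

Lemma expect1_ltyP s t : 0 <= s <= t -> (expect P N s (Some 1%N) t < +oo)%E <->
  at1 (on_reals (pgfs ell s t)) = 1%:E /\
  (at1 (derive1 (on_reals (pgfs ell s t))) < +oo)%E.
Proof.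
move=> st; rewrite (expectE bp)//.
exact: N0s_mean_ltyP (is_prob_offspring bk st).
Qed.

Lemma expect01_ltyP :
  (forall t, 0 <= t -> (expect P N 0 (Some 1%N) t < +oo)%E) <-> L1loc_mean.
Proof.
rewrite -(mean_ltyP bk fam gen avf).
by split=> fin t t0; have := fin t t0; rewrite (expectE bp) ?lexx.
Qed.

Lemma expect_lty n s t : 0 <= s <= t -> L1loc_mean ->
  (expect P N s (Some n) t < +oo)%E.
Proof.
move=> st meanL; rewrite (expect_mean bp)//.
by rewrite lte_mul_pinfty ?lee_fin// (mean_lty bk fam gen avf).
Qed.

Lemma expect_at1_derive n s t : 0 <= s <= t -> L1loc_mean ->
  expect P N s (Some n) t =
  (n%:R%:E * at1 (derive1 (on_reals (pgfs ell s t))))%E.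
Proof.
move=> st meanL; rewrite (expect_mean bp)//.
by rewrite (N0s_mean_at1 (is_prob_offspring bk st))// (mean_lty bk fam gen avf).
Qed.

Lemma expect_expR n s t : 0 <= s <= t -> L1loc_mean ->
  expect P N s (Some n) t =
  (n%:R * expR (- fine (\int[lebesgue_measure]_(r in `[s, t])
    at1 (derive1 (on_reals (herglotz q alpha ^~ r))))%E))%:E.
Proof.
move=> st meanL; rewrite (expect_mean bp)//.
by rewrite (mean_expR bk fam gen avf st meanL).
Qed.

End finite_means.

Unset Implicit Arguments.

Theorem mainTheorem18 (R : realType) (d : measure_display) (Omega : measurableType d)
  (P : R -> N0s -> probability Omega R) (N : R -> Omega -> N0s)
  (ell : R -> R -> N0s -> N0s -> R) (q : R -> R) (alpha : R -> nat -> R) :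
  branching_process P N ell ->
  abs_cont_rev_evol_family (pgfs ell) ->
  generating_family q alpha ->
  associated_vector_field (pgfs ell) (herglotz q alpha) ->
  [<-> (forall (n : nat) (s t : R), (0 < n)%N -> 0 <= s <= t ->
          (expect P N s (Some n) t < +oo)%E);
       (forall t : R, 0 <= t -> (expect P N 0 (Some 1%N) t < +oo)%E);
       (forall t : R, 0 <= t ->
          at1 (on_reals (pgfs ell 0 t)) = 1%:E /\
          (at1 (derive1 (on_reals (pgfs ell 0 t))) < +oo)%E);
       (forall s t : R, 0 <= s <= t ->
          at1 (on_reals (pgfs ell s t)) = 1%:E /\
          (at1 (derive1 (on_reals (pgfs ell s t))) < +oo)%E);
       {ae @lebesgue_measure R, forall t, 0 <= t ->
          at1 (on_reals (herglotz q alpha ^~ t)) = 0%:E} /\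
       L1loc (fun t => at1 (derive1 (on_reals (herglotz q alpha ^~ t))));
       {ae @lebesgue_measure R, forall t, 0 <= t -> q t = 0} /\
       L1loc (fun t => (\sum_(n <oo | n != 1%N) ((n.+1)%:R * alpha t n)%:E)%E)]
  /\
  ((forall (n : nat) (s t : R), (0 < n)%N -> 0 <= s <= t ->
      (expect P N s (Some n) t < +oo)%E) ->
   forall (n : nat) (s t : R), (0 < n)%N -> 0 <= s <= t ->
     expect P N s (Some n) t
       = ((n%:R)%:E * at1 (derive1 (on_reals (pgfs ell s t))))%E /\
     expect P N s (Some n) t
       = (n%:R * expR (- fine (\int[@lebesgue_measure R]_(r in `[s, t])
              at1 (derive1 (on_reals (herglotz q alpha ^~ r))))%E))%:E).
Proof.
move=> bp fam gen avf.
have le00 (t : R) : 0 <= t -> (0 : R) <= 0 <= t by rewrite lexx.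
have meanP := expect01_ltyP bp fam gen avf.
have at1_mean : (forall t : R, 0 <= t -> at1 (on_reals (pgfs ell 0 t)) = 1%:E /\
      (at1 (derive1 (on_reals (pgfs ell 0 t))) < +oo)%E) ->
    L1loc (fun r => N0s_mean (rates q alpha r)).
  move=> fin; apply/meanP => t t0.
  by apply/(expect1_ltyP bp (le00 t t0)); exact: fin.
split.
  tfae.
  - by move=> fin t /le00; exact: fin.
  - by move=> fin t t0; apply/(expect1_ltyP bp (le00 t t0)); exact: fin.
  - move=> /at1_mean meanL s t st; apply/(expect1_ltyP bp st).
    exact: (expect_lty bp fam gen avf _ st meanL).
  - move=> fin; apply/(L1loc_at1_derive_herglotzP gen)/at1_mean => t /le00.
    exact: fin.
  - move=> /(L1loc_at1_derive_herglotzP gen) meanL.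
    exact/(L1loc_weighted_ratesP gen).
  - move=> /(L1loc_weighted_ratesP gen) meanL n s t _ st.
    exact: (expect_lty bp fam gen avf _ st meanL).
move=> fin n s t _ st.
have meanL : L1loc (fun r => N0s_mean (rates q alpha r)).
  by apply/meanP => u /le00; exact: fin.
split; first exact: (expect_at1_derive bp fam gen avf _ st meanL).
exact: (expect_expR bp fam gen avf _ st meanL).
Qed.
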